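(* Let $V\in B^0$ satisfy $\varkappa:=(2\pi)^{-n}\|V\|_{B^0}<1$ and let $f\in B^0$. Then the Schrödinger equation $$(1-\Delta+V)u=f \quad\text{in }\mathbb R^n$$ admits a unique solution $\mathbf u\in B^2$, and the following estimate holds: $$\|\mathbf u\|_{B^2}\le(1-\varkappa)^{-1}\|f\|_{B^0}.$$
   Context: Functions are complex valued on $\mathbb R^n$; $\hat f(\xi)=\int_{\mathbb R^n}e^{-ix\cdot\xi}f(x)\,dx$ is the Fourier transform (extended to tempered distributions); $\langle\xi\rangle=\sqrt{1+|\xi|^2}$; $C_b^0$ is the space of bounded continuous functions on $\mathbb R^n$. For $s\ge0$, $B^s=\{f\in C_b^0:\ \langle\xi\rangle^s\hat f\in L^1(\mathbb R^n)\}$ with norm $\|f\|_{B^s}=\|\langle\xi\rangle^s\hat f\|_{L^1}$ (a Banach space). *)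

(* Defs.v *)
From HB Require Import structures.
From mathcomp Require Import all_boot all_order all_algebra.
From mathcomp Require Import all_classical all_reals all_analysis.
From mathcomp Require Import complex.

Set Implicit Arguments.
Unset Strict Implicit.
Unset Printing Implicit Defensive.

Import Order.TTheory GRing.Theory Num.Theory.
Import numFieldNormedType.Exports.

Local Open Scope classical_set_scope.
Local Open Scope ring_scope.
Local Open Scope complex_scope.

Definition rV_display : measure_display -> measure_display.
Proof. exact. Qed.

(* The sigma-algebra generated by the coordinates, i.e. the Borel one. *)
Section measurable_rV.
Context (R : realType) (n : nat).

Let coor (i : 'I_n) (x : 'rV[R]_n) : R := x ord0 i.

Let rV_set0 : g_sigma_preimage coor set0.
Proof. exact: sigma_algebra0. Qed.

Let rV_setC A : g_sigma_preimage coor A -> g_sigma_preimage coor (~` A).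
Proof. exact: sigma_algebraC. Qed.

Let rV_bigcup (F : (set 'rV[R]_n)^nat) :
  (forall i, g_sigma_preimage coor (F i)) ->
  g_sigma_preimage coor (\bigcup_i (F i)).
Proof. exact: sigma_algebra_bigcup. Qed.

HB.instance Definition _ := @isMeasurable.Build (rV_display default_measure_display)
  'rV[R]_n (g_sigma_preimage coor) rV_set0 rV_setC rV_bigcup.

End measurable_rV.

Lemma measurable_coor (R : realType) n (i : 'I_n) :
  measurable_fun [set: 'rV[R]_n] (fun x => x ord0 i).
Proof.
move=> _ Y mY; rewrite setTI; apply: sub_sigma_algebra => /=.
rewrite -bigcup_seq/=; exists i => /=; first by rewrite mem_index_enum.
by exists Y => //; rewrite setTI.
Qed.

Lemma measurable_fun_coorP d (T : measurableType d) (R : realType) n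
    (f : T -> 'rV[R]_n) :
  (forall i, measurable_fun [set: T] (fun x => f x ord0 i)) ->
  measurable_fun [set: T] f.
Proof.
move=> mf.
have : g_sigma_preimage (fun i => (fun x : 'rV[R]_n => x ord0 i) \o f)
    `<=` measurable.
  apply: smallest_sub; first exact: sigma_algebra_measurable.
  case: n => [|n] in f mf *; first by rewrite big_ord0.
  rewrite -bigcup_mkord_ord; apply: bigcup_sub => i Ii.
  by move=> A [B mB <-]; exact: mf.
rewrite g_sigma_preimage_comp => prefS _ A mA.
by apply: prefS; exists A.
Qed.

Definition rV_cons (R : realType) n (p : measurableTypeR R * 'rV[R]_n) :
    'rV[R]_n.+1 :=
  \row_i (if unlift ord0 i is Some j then p.2 ord0 j else p.1).

Definition rV_uncons (R : realType) n (x : 'rV[R]_n.+1) :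
    measurableTypeR R * 'rV[R]_n :=
  (x ord0 ord0, \row_j x ord0 (lift ord0 j)).

Lemma rV_consK (R : realType) n :
  cancel (@rV_cons R n) (@rV_uncons R n).
Proof.
move=> [a x]; rewrite /rV_uncons /rV_cons !mxE unlift_none; congr pair.
by apply/rowP => j; rewrite !mxE liftK.
Qed.

Lemma measurable_rV_cons (R : realType) n :
  measurable_fun [set: measurableTypeR R * 'rV[R]_n] (@rV_cons R n).
Proof.
apply: measurable_fun_coorP => i.
case: (unliftP ord0 i) => [j|] ->.
  rewrite (_ : (fun _ => _) = (fun x : 'rV[R]_n => x ord0 j) \o snd).
    by apply: measurableT_comp => //; exact: measurable_coor.
  by apply/funext => x; rewrite !mxE liftK.
rewrite (_ : (fun _ => _) = fst)//.
by apply/funext => x; rewrite !mxE unlift_none.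
Qed.

Lemma measurable_rV_uncons (R : realType) n :
  measurable_fun [set: 'rV[R]_n.+1] (@rV_uncons R n).
Proof.
apply/measurable_fun_pairP; split; first exact: measurable_coor.
apply: measurable_fun_coorP => i.
rewrite (_ : (fun _ => _) = fun x : 'rV[R]_n.+1 => x ord0 (lift ord0 i)).
  exact: measurable_coor.
by apply/funext => x; rewrite !mxE.
Qed.

Section lebesgue_step.
Context (R : realType) (n : nat).
Variable m : {sigma_finite_measure set 'rV[R]_n -> \bar R}.

Let mcons := pushforward (lebesgue_measure \x m)%E (@rV_cons R n).

Let mcons0 : mcons set0 = 0%E.
Proof. have mf := @measurable_rV_cons R n; exact: measure0. Qed.

Let mcons_ge0 A : (0 <= mcons A)%E.
Proof. have mf := @measurable_rV_cons R n; exact: measure_ge0. Qed.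

Let mcons_sigma_additive : semi_sigma_additive mcons.
Proof.
have mf := @measurable_rV_cons R n; exact: measure_semi_sigma_additive.
Qed.

HB.instance Definition _ := isMeasure.Build _ _ _ mcons
  mcons0 mcons_ge0 mcons_sigma_additive.

Let mcons_sigma_finite : sigma_finite setT mcons.
Proof.
have /sigma_finiteP[F [TF ndF Foo]] :=
  @sigma_finiteT _ _ _ (@lebesgue_measure R).
have /sigma_finiteP[G [TG ndG Goo]] := sigma_finiteT m.
exists (fun k => @rV_uncons R n @^-1` (F k `*` G k)).
  rewrite -preimage_bigcup (_ : \bigcup_k _ = setT) ?preimage_setT//.
  rewrite -setXTT TF TG predeqE => -[x y]; split.
    by move=> [k _ []/= ? ?]; split; exists k.
  move=> [/= [j _ Fjx] [k _ Gky]]; exists (maxn j k) => //; split.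
  - by move: x Fjx; exact/subsetPset/ndF/leq_maxl.
  - by move: y Gky; exact/subsetPset/ndG/leq_maxr.
move=> k; have [mFk Fk] := Foo k; have [mGk Gk] := Goo k; split.
  rewrite -[X in measurable X]setTI.
  by apply: measurable_rV_uncons => //; exact: measurableX.
rewrite /mcons /pushforward -comp_preimage.
rewrite (_ : _ \o _ = id); last by apply/funext => x /=; rewrite rV_consK.
rewrite preimage_id.
by rewrite product_measure1E// lte_mul_pinfty// ge0_fin_numE.
Qed.

HB.instance Definition _ := Measure_isSigmaFinite.Build _ _ _ mcons
  mcons_sigma_finite.

Definition lebesgue_cons : {sigma_finite_measure set 'rV[R]_n.+1 -> \bar R} :=
  mcons.

End lebesgue_step.

(* rV_cons pushes lebesgue_measure \x lebesgue_rV n to lebesgue_rV n.+1; see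
   lebesgue_rV_box for the values on boxes. *)
Fixpoint lebesgue_rV (R : realType) (n : nat) :
    {sigma_finite_measure set 'rV[R]_n -> \bar R} :=
  if n is k.+1 then lebesgue_cons (lebesgue_rV R k) else \d_(0 : 'rV[R]_0).

Lemma lebesgue_rV_box (R : realType) n (A : 'I_n -> set (measurableTypeR R)) :
  (forall i, measurable (A i)) ->
  lebesgue_rV R n [set x | forall i, A i (x ord0 i)] =
  (\prod_(i < n) lebesgue_measure (A i))%E.
Proof.
elim: n A => [|n IHn] A mA.
  rewrite big_ord0 /= diracE mem_set//.
  by move=> [].
rewrite big_ord_recl -IHn//.
have mB : measurable [set x : 'rV[R]_n | forall i, A (lift ord0 i) (x ord0 i)].
  rewrite (_ : [set x | _] = \bigcap_(i in [set: 'I_n])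
      ((fun x : 'rV[R]_n => x ord0 i) @^-1` A (lift ord0 i))); last first.
    apply/seteqP; split => x /= xA; first by move=> i _; exact: xA.
    by move=> i; exact: xA.
  apply: fin_bigcap_measurable => //= i _.
  rewrite -[X in measurable X]setTI.
  by apply: measurable_coor => //; exact: mA.
rewrite -product_measure1E//.
rewrite /= /pushforward; congr (_ _); apply/seteqP; split => -[a x] /=.
- move=> xA; split; first by have := xA ord0; rewrite mxE unlift_none.
  by move=> i; have := xA (lift ord0 i); rewrite mxE liftK.
- move=> [aA xA] i; rewrite mxE.
  by case: unliftP => [j|] ->; [exact: xA | exact: aA].
Qed.

(* The library norm on 'rV[R]_n is the sup norm: it is only used here through
   the topology and differentiability, never for |xi|. *)

Section complex_functions.
Context (R : realType) (n : nat).
Implicit Types (f g phi u V : 'rV[R]_n -> R[i]) (x xi : 'rV[R]_n).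

Local Notation mu := (lebesgue_rV R n).

Definition Cintegrable f : Prop :=
  mu.-integrable setT (EFin \o (@complex.Re R \o f)) /\
  mu.-integrable setT (EFin \o (@complex.Im R \o f)).

Definition Cintegral f : R[i] :=
  (\int[mu]_x complex.Re (f x)) +i* (\int[mu]_x complex.Im (f x)).

Definition Cnorm (z : R[i]) : R := ComplexField.Normc.normc z.

Definition L1norm f : R := \int[mu]_x Cnorm (f x).

Definition Ccontinuous f : Prop :=
  continuous (@complex.Re R \o f) /\ continuous (@complex.Im R \o f).

Definition Cb0 f : Prop :=
  Ccontinuous f /\ exists M : R, forall x, Cnorm (f x) <= M.

Definition unit_vec (i : 'I_n) : 'rV[R]_n := delta_mx ord0 i.

Definition partially_derivable (i : 'I_n) f : Prop :=
  forall x, derivable (@complex.Re R \o f) x (unit_vec i) /\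
            derivable (@complex.Im R \o f) x (unit_vec i).

Definition partial (i : 'I_n) f : 'rV[R]_n -> R[i] := fun x =>
  'D_(unit_vec i) (@complex.Re R \o f) x +i* 'D_(unit_vec i) (@complex.Im R \o f) x.

Definition iter_partial (s : seq 'I_n) f : 'rV[R]_n -> R[i] :=
  foldr partial f s.

Definition laplacian f : 'rV[R]_n -> R[i] := fun x =>
  \sum_(i < n) partial i (partial i f) x.

Definition dotp x xi : R := \sum_(i < n) x ord0 i * xi ord0 i.

Definition japanese xi : R := Num.sqrt (1 + dotp xi xi).

Definition expi (t : R) : R[i] := cos t +i* sin t.

Definition fourier_integral f : 'rV[R]_n -> R[i] := fun xi =>
  Cintegral (fun x => expi (- dotp x xi) * f x).

Definition smooth phi : Prop := forall (s : seq 'I_n) x,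
  differentiable (@complex.Re R \o iter_partial s phi) x /\
  differentiable (@complex.Im R \o iter_partial s phi) x.

Definition schwartz phi : Prop :=
  smooth phi /\
  forall (s : seq 'I_n) (k : nat), exists M : R, forall x,
    japanese x ^+ k * Cnorm (iter_partial s phi x) <= M.

(* [f], seen as a tempered distribution, has a Fourier transform given by the
   integrable function [g]: <f^, phi> = <f, phi^> for all Schwartz phi. *)
Definition has_fourier f g : Prop :=
  Cintegrable g /\
  forall phi, schwartz phi ->
    Cintegral (fun x => f x * fourier_integral phi x) =
    Cintegral (fun xi => g xi * phi xi).

(* A density of f^ (determined up to a null set) when f^ is in L^1. *)
Definition fourier f : 'rV[R]_n -> R[i] :=
  xget (fun=> 0) [set g | has_fourier f g].

(* Meant for s >= 0: then <xi>^s f^ in L^1 forces f^ in L^1, so it is harmless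
   that has_fourier only looks at integrable densities. *)

Definition weighted (s : R) g : 'rV[R]_n -> R[i] := fun xi =>
  (japanese xi `^ s)%:C * g xi.

Definition barron (s : R) f : Prop :=
  Cb0 f /\ exists g, has_fourier f g /\ Cintegrable (weighted s g).

Definition barron_norm (s : R) f : R := L1norm (weighted s (fourier f)).

(* Classical solutions. Functions in B^2 are of class C^2, so differentiability
   is not a restriction on them. *)
Definition schrodinger_solution V f u : Prop :=
  (forall i, partially_derivable i u) /\
  (forall i, partially_derivable i (partial i u)) /\
  forall x, u x - laplacian u x + V x * u x = f x.

End complex_functions.

(* Main.v *)
(* Idea: on the Fourier side the equation reads S + c (V^ * (S / <xi>^2)) = f^
   for S = <xi>^2 u^ and c = (2 pi)^-n. The map S -> c (V^ * S) has norm at most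
   c |V^|_1 = kappa < 1 on L^1 and dividing by <xi>^2 only decreases norms, so the
   Neumann series for S converges in L^1 with |S|_1 <= |f^|_1 / (1 - kappa), and
   the same contraction estimate gives uniqueness.
   Going back and forth between functions and densities needs two facts about the
   weak Fourier transform: testing against e^{i x0 xi - t^2 |xi|^2 / 4} and letting
   t -> 0 shows that a bounded continuous f with density g equals
   c \int e^{i x xi} g(xi) dxi everywhere, and this integral determines g almost
   everywhere. Applied to Schwartz functions, the first fact also yields their
   inversion formula, hence the converse: every g in L^1 is the density of
   c \int e^{i x xi} g(xi) dxi. *)
Require Import Defs.
From mathcomp Require Import all_boot all_order all_algebra.
From mathcomp Require Import all_classical all_reals all_analysis.
From mathcomp Require Import measurable_realfun complex ring lra.

Set Implicit Arguments.
Unset Strict Implicit.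
Unset Printing Implicit Defensive.

Import Order.TTheory GRing.Theory Num.Theory.
Import numFieldNormedType.Exports.

Local Open Scope classical_set_scope.
Local Open Scope ring_scope.
Local Open Scope complex_scope.

(** The equation is handled through [cofourier], the unnormalised inverse transform, evaluated point
    by point: there a convolution is a product of numbers and the Neumann series is a numerical
    series. An identity between densities themselves is extracted only twice, for the contraction
    estimate behind uniqueness and for the norm of the chosen density [fourier u]; injectivity of
    [cofourier] serves exactly there. That injectivity climbs from Gaussians to bounded continuous
    functions, then to indicators of orthants, then to all measurable sets. Since [has_fourier]
    tests against Schwartz functions, modulated Gaussians have to be shown Schwartz and Schwartz
    functions have to be shown to possess integrable transforms. Decay is measured by the product of
    the (1 + x_i^2)^-1, because its integral factors over the coordinates. The transform of a
    Gaussian comes from a real differential equation along a line, without contour integration. *)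

Local Notation Re := (@complex.Re _).
Local Notation Im := (@complex.Im _).

(** * Complex-valued functions and their integrals *)

Section complex_numbers.
Context {R : realType}.
Implicit Types (a b z : R[i]) (t : R).

Lemma ReD a b : Re (a + b) = Re a + Re b. Proof. by case: a; case: b. Qed.
Lemma ImD a b : Im (a + b) = Im a + Im b. Proof. by case: a; case: b. Qed.
Lemma ReN a : Re (- a) = - Re a. Proof. by case: a. Qed.
Lemma ImN a : Im (- a) = - Im a. Proof. by case: a. Qed.
Lemma ReB a b : Re (a - b) = Re a - Re b. Proof. by rewrite ReD ReN. Qed.
Lemma ImB a b : Im (a - b) = Im a - Im b. Proof. by rewrite ImD ImN. Qed.
Lemma ReM a b : Re (a * b) = Re a * Re b - Im a * Im b.
Proof. by case: a; case: b. Qed.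
Lemma ImM a b : Im (a * b) = Re a * Im b + Im a * Re b.
Proof. by case: a; case: b. Qed.
Definition ReImE := (ReB, ImB, ReD, ImD, ReN, ImN, ReM, ImM).

Lemma complex_ext a b : Re a = Re b -> Im a = Im b -> a = b.
Proof. by case: a => ? ?; case: b => ? ? /= -> ->. Qed.

Lemma CnormE z : Cnorm z = Num.sqrt (Re z ^+ 2 + Im z ^+ 2).
Proof. by case: z. Qed.

Lemma Cnorm_ge0 z : 0 <= Cnorm z.
Proof. by rewrite CnormE sqrtr_ge0. Qed.

Lemma CnormM a b : Cnorm (a * b) = Cnorm a * Cnorm b.
Proof. exact: ComplexField.Normc.normcM. Qed.

Lemma CnormD a b : Cnorm (a + b) <= Cnorm a + Cnorm b.
Proof. exact: le_normcD. Qed.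

Lemma Cnorm0 : Cnorm (0 : R[i]) = 0.
Proof. exact: ComplexField.Normc.normc0. Qed.

Lemma Cnorm_eq0 z : Cnorm z = 0 -> z = 0.
Proof. exact: ComplexField.Normc.eq0_normc. Qed.

Lemma Cnorm_real t : Cnorm t%:C = `|t|.
Proof. by rewrite CnormE /= expr0n addr0 sqrtr_sqr. Qed.

Lemma Cnorm_expi t : Cnorm (expi t) = 1.
Proof. by rewrite CnormE /= cos2Dsin2 sqrtr1. Qed.

Lemma Cnorm_imag t : Cnorm (0 +i* t) = `|t|.
Proof. by rewrite CnormE /= expr0n add0r sqrtr_sqr. Qed.

Lemma Re_le_Cnorm z : `|Re z| <= Cnorm z.
Proof. by rewrite CnormE -sqrtr_sqr ler_wsqrtr// lerDl sqr_ge0. Qed.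

Lemma Im_le_Cnorm z : `|Im z| <= Cnorm z.
Proof. by rewrite CnormE -sqrtr_sqr ler_wsqrtr// lerDr sqr_ge0. Qed.

Lemma Cnorm_le_ReIm z : Cnorm z <= `|Re z| + `|Im z|.
Proof.
have -> : z = (Re z)%:C + (0 +i* Im z).
  by apply: complex_ext; rewrite ReImE /= ?addr0 ?add0r.
by rewrite (le_trans (CnormD _ _))// Cnorm_real Cnorm_imag ReImE /= addr0 add0r.
Qed.

Lemma expiD s t : expi (s + t) = expi s * expi t :> R[i].
Proof. by apply: complex_ext; rewrite /= ?cosD ?sinD// addrC mulrC addrC. Qed.

Lemma expi0 : expi 0 = 1 :> R[i].
Proof. by rewrite /expi cos0 sin0. Qed.

Lemma expiNK t : expi (- t) * expi t = 1 :> R[i].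
Proof. by rewrite -expiD addNr expi0. Qed.

End complex_numbers.

Section complex_convergence.
Context {R : realType}.
Implicit Types (u v : nat -> R[i]) (a b : R[i]).

(** Convergence is required of real and imaginary parts, so that limit theorems over [R] apply
    directly and no topology on [R[i]] is involved. *)
Definition cvgC u a := Re (u k) @[k --> \oo] --> Re a /\ Im (u k) @[k --> \oo] --> Im a.

Lemma cvgC_unique u a b : cvgC u a -> cvgC u b -> a = b.
Proof.
move=> [ra ia] [rb ib]; apply: complex_ext.
  exact: (cvg_unique _ ra rb).
exact: (cvg_unique _ ia ib).
Qed.

Lemma cvgC_cst a : cvgC (fun=> a) a.
Proof. by split; exact: cvg_cst. Qed.

Lemma cvgCD u v a b : cvgC u a -> cvgC v b -> cvgC (fun k => u k + v k) (a + b).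
Proof.
move=> [ra ia] [rb ib]; split; under eq_cvg do rewrite ReImE; rewrite ReImE.
  exact: cvgD.
exact: cvgD.
Qed.

Lemma cvgCM u v a b : cvgC u a -> cvgC v b -> cvgC (fun k => u k * v k) (a * b).
Proof.
move=> [ra ia] [rb ib]; split; under eq_cvg do rewrite ReImE; rewrite ReImE.
  by apply: cvgB; apply: cvgM.
by apply: cvgD; apply: cvgM.
Qed.

Lemma cvgC_shift u a : cvgC u a -> cvgC (fun k => u k.+1) a.
Proof. by move=> [ra ia]; split; rewrite (cvg_shiftS (fun k => _ (u k))). Qed.

Lemma cvgC_Cnorm u a : cvgC u a -> Cnorm (u k) @[k --> \oo] --> Cnorm a.
Proof.
move=> [ra ia]; under eq_cvg do rewrite CnormE; rewrite CnormE.
have h : (Re (u k) ^+ 2 + Im (u k) ^+ 2) @[k --> \oo] --> Re a ^+ 2 + Im a ^+ 2.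
  by apply: cvgD; rewrite expr2; under eq_cvg do rewrite expr2; apply: cvgM.
exact: (continuous_cvg _ (@sqrt_continuous R _) h).
Qed.

End complex_convergence.

Section complex_integral.
Context d (T : measurableType d) (R : realType) (m : {measure set T -> \bar R}).
Implicit Types (f g : T -> R[i]) (h : T -> R) (z : R[i]).

Definition Cmeasurable f :=
  measurable_fun setT (fun x => Re (f x)) /\ measurable_fun setT (fun x => Im (f x)).

(** [integrableC] and [integralC] are [Cintegrable] and [Cintegral] over an arbitrary measure, since
    Fubini needs product spaces; for [lebesgue_rV] both pairs are convertible and are exchanged
    silently. *)
Definition integrableC f :=
  m.-integrable setT (EFin \o (fun x => Re (f x))) /\
  m.-integrable setT (EFin \o (fun x => Im (f x))).

Definition integralC f : R[i] := (\int[m]_x Re (f x)) +i* (\int[m]_x Im (f x)).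

Lemma Cmeasurable_cst z : Cmeasurable (cst z).
Proof. by split; exact: measurable_cst. Qed.

Lemma Cmeasurable_real h : measurable_fun setT h -> Cmeasurable (fun x => (h x)%:C).
Proof. by move=> mh; split => //=; exact: measurable_cst. Qed.

Lemma CmeasurableD f g : Cmeasurable f -> Cmeasurable g -> Cmeasurable (fun x => f x + g x).
Proof.
move=> [fr fi] [gr gi]; split.
  by under eq_fun do rewrite ReImE; exact: measurable_funD.
by under eq_fun do rewrite ReImE; exact: measurable_funD.
Qed.

Lemma CmeasurableM f g : Cmeasurable f -> Cmeasurable g -> Cmeasurable (fun x => f x * g x).
Proof.
move=> [fr fi] [gr gi]; split.
  by under eq_fun do rewrite ReImE; apply: measurable_funB; exact: measurable_funM.
by under eq_fun do rewrite ReImE; apply: measurable_funD; exact: measurable_funM.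
Qed.

Lemma measurable_Cnorm f : Cmeasurable f -> measurable_fun setT (fun x => Cnorm (f x)).
Proof.
move=> [fr fi]; under eq_fun do rewrite CnormE.
have ms : measurable_fun setT (@Num.sqrt R).
  by apply: continuous_measurable_fun; exact: sqrt_continuous.
by apply: (measurableT_comp ms); apply: measurable_funD; exact: measurable_funX.
Qed.

Lemma Cmeasurable_lim (u : nat -> T -> R[i]) f : (forall k, Cmeasurable (u k)) ->
  (forall x, cvgC (u ^~ x) (f x)) -> Cmeasurable f.
Proof.
move=> mu uf; split.
  apply: (measurable_fun_cvg (fun k => (mu k).1)) => x _; exact: (uf x).1.
apply: (measurable_fun_cvg (fun k => (mu k).2)) => x _; exact: (uf x).2.
Qed.

Lemma integrableC_measurable f : integrableC f -> Cmeasurable f.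
Proof.
by move=> [/measurable_int/measurable_EFinP ? /measurable_int/measurable_EFinP ?].
Qed.

Lemma integrableRD h1 h2 : m.-integrable setT (EFin \o h1) ->
  m.-integrable setT (EFin \o h2) -> m.-integrable setT (EFin \o (fun x => h1 x + h2 x)).
Proof. by move=> i1 i2; exact: (integrableD measurableT i1 i2). Qed.

Lemma integrableRZ k h : m.-integrable setT (EFin \o h) ->
  m.-integrable setT (EFin \o (fun x => k * h x)).
Proof. by move=> i1; exact: (integrableZl measurableT k i1). Qed.

Lemma le_integrableR h1 h2 : measurable_fun setT h1 ->
  m.-integrable setT (EFin \o h2) -> (forall x, `|h1 x| <= h2 x) ->
  m.-integrable setT (EFin \o h1).
Proof.
move=> m1 i2 h12; apply: (le_integrable _ _ _ i2) => //; first exact/measurable_EFinP.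
by move=> x _ /=; rewrite lee_fin (le_trans (h12 x))// ler_norm.
Qed.

Lemma le_integrableC f h : Cmeasurable f -> m.-integrable setT (EFin \o h) ->
  (forall x, Cnorm (f x) <= h x) -> integrableC f.
Proof.
move=> [mr mi] ih fh; split; apply: (le_integrableR _ ih) => // x.
  by rewrite (le_trans (Re_le_Cnorm _)).
by rewrite (le_trans (Im_le_Cnorm _)).
Qed.

Lemma integrable_Cnorm f : integrableC f ->
  m.-integrable setT (EFin \o (fun x => Cnorm (f x))).
Proof.
move=> fi; have mf := integrableC_measurable fi; case: fi => fr fi.
have ih : m.-integrable setT (EFin \o (fun x => `|Re (f x)| + `|Im (f x)|)).
  by apply: integrableRD; exact: integrable_norm.
apply: (le_integrableR _ ih); first exact: measurable_Cnorm.
by move=> x; rewrite ger0_norm ?Cnorm_ge0 ?Cnorm_le_ReIm.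
Qed.

Lemma integrableC_ltyP f :
  integrableC f <-> Cmeasurable f /\ (\int[m]_x (Cnorm (f x))%:E < +oo)%E.
Proof.
split=> [fi|[mf flt]].
  split; first exact: integrableC_measurable.
  have /integrableP[_] := integrable_Cnorm fi.
  by under eq_integral do rewrite /= ger0_norm ?Cnorm_ge0//.
apply: (le_integrableC mf (h := fun x => Cnorm (f x))) => //.
apply/integrableP; split; first exact/measurable_EFinP/measurable_Cnorm.
by under eq_integral do rewrite /= ger0_norm ?Cnorm_ge0//.
Qed.

Lemma integrableCD f g : integrableC f -> integrableC g -> integrableC (fun x => f x + g x).
Proof.
move=> [fr fi] [gr gi]; split.
  by under [X in EFin \o X]eq_fun do rewrite ReImE; exact: integrableRD.
by under [X in EFin \o X]eq_fun do rewrite ReImE; exact: integrableRD.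
Qed.

Lemma integrableCZ z f : integrableC f -> integrableC (fun x => z * f x).
Proof.
move=> fi; have mf := integrableC_measurable fi.
apply: (le_integrableC (h := fun x => Cnorm z * Cnorm (f x))).
- by apply: CmeasurableM => //; exact: Cmeasurable_cst.
- by apply: integrableRZ; exact: integrable_Cnorm.
- by move=> x; rewrite CnormM.
Qed.

Lemma integrableCN f : integrableC f -> integrableC (fun x => - f x).
Proof.
by move=> /(integrableCZ (-1)); under eq_fun do rewrite mulN1r.
Qed.

Lemma integrableCB f g : integrableC f -> integrableC g -> integrableC (fun x => f x - g x).
Proof. by move=> fi gi; apply: integrableCD => //; exact: integrableCN. Qed.

Lemma integrableC0 : integrableC (cst 0).
Proof. by split; exact: integrable0. Qed.

Lemma integrableC_sum (I : Type) (s : seq I) (u : I -> T -> R[i]) :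
  (forall k, integrableC (u k)) -> integrableC (fun x => \sum_(k <- s) u k x).
Proof.
move=> ui; elim: s => [|k s IHs].
  by under eq_fun do rewrite big_nil; exact: integrableC0.
by under eq_fun do rewrite big_cons; exact: integrableCD.
Qed.

Lemma integralCD f g : integrableC f -> integrableC g ->
  integralC (fun x => f x + g x) = integralC f + integralC g.
Proof.
move=> [fr fi] [gr gi]; apply: complex_ext; rewrite ReImE /=.
  by under eq_Rintegral do rewrite ReImE; rewrite RintegralD.
by under eq_Rintegral do rewrite ReImE; rewrite RintegralD.
Qed.

Lemma integralCZ z f : integrableC f -> integralC (fun x => z * f x) = z * integralC f.
Proof.
move=> [fr fi]; apply: complex_ext; rewrite ReImE /=.
  under eq_Rintegral do rewrite ReImE.
  by rewrite RintegralB ?RintegralZl//; exact: integrableRZ.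
under eq_Rintegral do rewrite ReImE.
by rewrite RintegralD ?RintegralZl//; exact: integrableRZ.
Qed.

Lemma integralC0 : integralC (cst 0) = 0.
Proof. by rewrite /integralC /= /Rintegral integral0. Qed.

Lemma integralC_sum (I : Type) (s : seq I) (u : I -> T -> R[i]) :
  (forall k, integrableC (u k)) ->
  integralC (fun x => \sum_(k <- s) u k x) = \sum_(k <- s) integralC (u k).
Proof.
move=> ui; elim: s => [|k s IHs].
  rewrite big_nil (_ : (fun x => _) = cst 0) ?integralC0//.
  by apply/funext => x; rewrite big_nil.
rewrite big_cons -IHs -integralCD//; last exact: integrableC_sum.
by congr integralC; apply/funext => x; rewrite big_cons.
Qed.

(* Multiplying by the conjugate of [z := integralC f] reduces the claim to real
   parts: [|z|^2 = \int Re (z^* f) <= |z| \int |f|]. *)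
Lemma Cnorm_integralC f : integrableC f ->
  Cnorm (integralC f) <= \int[m]_x Cnorm (f x).
Proof.
move=> fi; set z := integralC f; set r := \int[m]_x _.
have r0 : 0 <= r by apply: Rintegral_ge0 => x _; exact: Cnorm_ge0.
have [z0|z0] := eqVneq (Cnorm z) 0; first by rewrite z0.
have zp : 0 < Cnorm z by rewrite lt_def z0 Cnorm_ge0.
pose w := Re z -i* Im z.
have wz : Cnorm w = Cnorm z by rewrite !CnormE /= sqrrN.
have zz : Re (w * z) = Cnorm z * Cnorm z.
  by rewrite -expr2 CnormE sqr_sqrtr ?addr_ge0 ?sqr_ge0// ReImE /=; ring.
have ifr := integrable_Cnorm fi.
have : Re (w * z) <= Cnorm z * r.
  rewrite -integralCZ//= -RintegralZl//; apply: le_Rintegral => //.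
  - exact: (integrableCZ w fi).1.
  - exact: integrableRZ.
  - move=> x _; rewrite (le_trans (ler_norm _))// (le_trans (Re_le_Cnorm _))//.
    by rewrite CnormM wz.
by rewrite zz ler_pM2l.
Qed.

Lemma dominated_convergenceC (u : nat -> T -> R[i]) f h :
  (forall k, Cmeasurable (u k)) -> (forall x, cvgC (u ^~ x) (f x)) ->
  m.-integrable setT (EFin \o h) -> (forall k x, Cnorm (u k x) <= h x) ->
  integrableC f /\ cvgC (fun k => integralC (u k)) (integralC f).
Proof.
move=> mu uf ih uh; have mf := Cmeasurable_lim mu uf.
have fh x : Cnorm (f x) <= h x.
  by apply: (cvgr_to_le (cvgC_Cnorm (uf x))); apply: nearW => k; exact: uh.
have fi := le_integrableC mf ih fh; split => //; split.
  apply: fine_cvg; rewrite fineK; last exact: (integrable_fin_num measurableT fi.1).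
  have [||||] := @dominated_convergence _ _ _ m _ measurableT
    (fun k x => (Re (u k x))%:E) (fun x => (Re (f x))%:E) (EFin \o h) _ _ _ ih _ => //.
  - by move=> k; exact/measurable_EFinP/(mu k).1.
  - exact/measurable_EFinP/mf.1.
  - by apply: aeW => x _; apply: cvg_EFin; [exact: nearW|exact: (uf x).1].
  - apply: aeW => x k _; rewrite /= lee_fin.
    by rewrite (le_trans (Re_le_Cnorm _)).
apply: fine_cvg; rewrite fineK; last exact: (integrable_fin_num measurableT fi.2).
have [||||] := @dominated_convergence _ _ _ m _ measurableT
  (fun k x => (Im (u k x))%:E) (fun x => (Im (f x))%:E) (EFin \o h) _ _ _ ih _ => //.
- by move=> k; exact/measurable_EFinP/(mu k).2.
- exact/measurable_EFinP/mf.2.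
- by apply: aeW => x _; apply: cvg_EFin; [exact: nearW|exact: (uf x).2].
- apply: aeW => x k _; rewrite /= lee_fin.
  by rewrite (le_trans (Im_le_Cnorm _)).
Qed.

Lemma ae_eq_integralC f g : Cmeasurable f -> Cmeasurable g ->
  {ae m, forall x, f x = g x} -> integralC f = integralC g.
Proof.
move=> mf mg fg; rewrite /integralC /Rintegral; congr (fine _ +i* fine _).
  apply: ae_eq_integral => //; [exact/measurable_EFinP/mf.1|exact/measurable_EFinP/mg.1|].
  by apply: filterS fg => x /= ->.
apply: ae_eq_integral => //; [exact/measurable_EFinP/mf.2|exact/measurable_EFinP/mg.2|].
by apply: filterS fg => x /= ->.
Qed.

End complex_integral.

(** * Fubini's theorem for complex-valued integrands *)

Section product_integral.
Context d1 d2 (T1 : measurableType d1) (T2 : measurableType d2) (R : realType).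
Context (m1 : {sigma_finite_measure set T1 -> \bar R}).
Context (m2 : {sigma_finite_measure set T2 -> \bar R}).

(** An integrable [F] is finite off a null set, so sending its infinite values to the default 0 of
    [fine] changes no integral. This carries Fubini, whose partial integrals are extended reals,
    over to real integrals. *)
Lemma fine_ae_integrable d (T : measurableType d) (m : {measure set T -> \bar R})
    (F : T -> \bar R) : m.-integrable setT F ->
  m.-integrable setT (EFin \o (fine \o F)) /\ \int[m]_x fine (F x) = fine (\int[m]_x F x)%E.
Proof.
move=> iF; have mF := measurable_int _ iF.
have mfF : measurable_fun setT (EFin \o (fine \o F)).
  by apply/measurable_EFinP; exact: measurableT_comp.
split.
  apply: (le_integrable _ _ _ iF) => // x _ /=.
  by case: (F x) => [r| |] /=; rewrite ?normr0 ?leey.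
rewrite /Rintegral; congr fine; apply: ae_eq_integral => //.
apply: filterS (integrable_ae measurableT iF) => x /(_ I) Fx _ /=.
by rewrite fineK.
Qed.

Lemma Rintegral_prod1 (f : T1 * T2 -> R) : (m1 \x m2)%E.-integrable setT (EFin \o f) ->
  m1.-integrable setT (EFin \o (fun x => \int[m2]_y f (x, y))) /\
  \int[m1]_x (\int[m2]_y f (x, y)) = fine (\int[(m1 \x m2)%E]_z (f z)%:E)%E.
Proof.
move=> fi; have [iF eF] := fine_ae_integrable (integrable_fubini_F fi).
by split => //; rewrite -(integral12_prod_meas1 fi).
Qed.

Lemma integrable_fubini_G (f : T1 * T2 -> \bar R) :
  (m1 \x m2)%E.-integrable setT f -> m2.-integrable setT (fubini_G m1 f).
Proof.
move=> fi; have mf := measurable_int _ fi.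
have maf : measurable_fun setT (abse \o f).
  exact: (@measurableT_comp _ _ _ _ _ _ abse).
apply/integrableP; split; first exact: (measurable_fubini_G fi).
have h := (integrable21ltyP m1 m2 mf).1 fi.
apply: le_lt_trans h; apply: ge0_le_integral => //.
- apply: (@measurableT_comp _ _ _ _ _ _ abse) => //.
  exact: (measurable_fubini_G fi).
- exact: (measurable_fun_fubini_tonelli_G (abse \o f)%E maf (fun=> abse_ge0 _)).
- move=> y _; apply: le_abse_integral => //.
  exact: (measurable_fun_pair1 _ mf).
Qed.

Lemma Rintegral_prod2 (f : T1 * T2 -> R) : (m1 \x m2)%E.-integrable setT (EFin \o f) ->
  m2.-integrable setT (EFin \o (fun y => \int[m1]_x f (x, y))) /\
  \int[m2]_y (\int[m1]_x f (x, y)) = fine (\int[(m1 \x m2)%E]_z (f z)%:E)%E.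
Proof.
move=> fi; have [iG eG] := fine_ae_integrable (integrable_fubini_G fi).
by split => //; rewrite -(integral21_prod_meas1 fi).
Qed.

Implicit Types F : T1 * T2 -> R[i].

Lemma integrableC_prod F : Cmeasurable F ->
  (\int[m1]_x \int[m2]_y (Cnorm (F (x, y)))%:E < +oo)%E -> integrableC (m1 \x m2)%E F.
Proof.
move=> mF Flt.
have mN : measurable_fun setT (EFin \o (fun z => Cnorm (F z))).
  exact/measurable_EFinP/measurable_Cnorm.
apply: (le_integrableC mF (h := fun z => Cnorm (F z))) => //.
apply/integrable12ltyP => //.
by under eq_integral do under eq_integral do rewrite /= ger0_norm ?Cnorm_ge0//.
Qed.

Lemma integrableC_integral2 F : integrableC (m1 \x m2)%E F ->
  integrableC m1 (fun x => integralC m2 (fun y => F (x, y))).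
Proof. by move=> [Fr Fi]; split; [case: (Rintegral_prod1 Fr)|case: (Rintegral_prod1 Fi)]. Qed.

Lemma FubiniC F : integrableC (m1 \x m2)%E F ->
  integralC m1 (fun x => integralC m2 (fun y => F (x, y))) =
  integralC m2 (fun y => integralC m1 (fun x => F (x, y))).
Proof.
move=> [Fr Fi]; apply: complex_ext => /=.
  by rewrite (Rintegral_prod1 Fr).2 (Rintegral_prod2 Fr).2.
by rewrite (Rintegral_prod1 Fi).2 (Rintegral_prod2 Fi).2.
Qed.

Lemma ECnorm_integralC d (T : measurableType d) (m : {measure set T -> \bar R})
    (f : T -> R[i]) : Cmeasurable f ->
  ((Cnorm (integralC m f))%:E <= \int[m]_x (Cnorm (f x))%:E)%E.
Proof.
move=> mf; have [|] := ltP (\int[m]_x (Cnorm (f x))%:E)%E +oo%E; last first.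
  by rewrite leye_eq => /eqP ->; exact: leey.
move=> flt; have fi : integrableC m f by apply/integrableC_ltyP.
have := Cnorm_integralC fi; rewrite -lee_fin => /le_trans; apply.
rewrite /Rintegral fineK//.
exact: (integrable_fin_num measurableT (integrable_Cnorm fi)).
Qed.

End product_integral.

(** * Lebesgue measure on row vectors *)

Section lebesgue_affine.
Context {R : realType}.
Local Open Scope ereal_scope.
Implicit Types (a t : R).

(** The image of Lebesgue measure under x -> a + t x, multiplied by t, gives each half-open interval
    its length, hence is Lebesgue measure again by uniqueness. *)
Lemma ge0_integral_lebesgue_affine a t (F : R -> \bar R) : (0 < t)%R ->
  measurable_fun setT F -> (forall x, 0 <= F x) ->
  \int[lebesgue_measure]_x F (a + t * x)%R =
  (t^-1)%:E * \int[lebesgue_measure]_x F x.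
Proof.
move=> t0 mF F0.
pose phi (x : measurableTypeR R) : measurableTypeR R := (a + t * x)%R.
have mphi : measurable_fun setT phi.
  apply: measurable_funD; first exact: measurable_cst.
  by apply: measurable_funM => //; exact: measurable_cst.
(* The instance is given by name: Defs declares another one on a term that
   unfolds to a pushforward, and it takes precedence. *)
have @nu : {measure set (measurableTypeR R) -> \bar R}.
  exact: (mscale (NngNum (ltW t0))
    (measure_function_pushforward__canonical__measure_function_Measure lebesgue_measure mphi)).
have nuE : forall A, measurable A -> lebesgue_measure A = nu A.
  apply: lebesgue_measure_unique => _ [[x y]] _ <-.
  transitivity (t%:E * lebesgue_measure (phi @^-1` `]x, y]%classic)); last by [].
  have -> : phi @^-1` `]x, y]%classic = `]((x - a) / t)%R, ((y - a) / t)%R]%classic.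
    apply/seteqP; split => z /=; rewrite !in_itv /= /phi.
      by rewrite ltr_pdivrMr// ler_pdivlMr// ltrBlDl lerBrDl mulrC.
    by rewrite ltr_pdivrMr// ler_pdivlMr// ltrBlDl lerBrDl mulrC.
  rewrite !lebesgue_measure_itv/= !lte_fin ltr_pM2r ?invr_gt0// ltrD2r.
  case: ifPn => _; last by rewrite mule0.
  by rewrite -!EFinB -EFinM; congr EFin; field; rewrite gt_eqF.
have tI : (t^-1)%:E * t%:E = 1 :> \bar R by rewrite -EFinM mulVf// gt_eqF.
transitivity ((t^-1)%:E * \int[nu]_x F x).
  rewrite /nu ge0_integral_mscale//= muleA tI mul1e.
  by rewrite (ge0_integral_pushforward mphi)//=.
congr (_ * _); apply: eq_measure_integral => A mA _.
exact: esym (nuE _ _).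
Qed.

End lebesgue_affine.

Section rV_integral.
Context {R : realType}.
Local Open Scope ereal_scope.

Lemma ge0_integral_rVS n (F : 'rV[R]_n.+1 -> \bar R) : measurable_fun setT F ->
  (forall x, 0 <= F x) ->
  \int[lebesgue_rV R n.+1]_x F x =
  \int[lebesgue_measure]_a \int[lebesgue_rV R n]_y F (rV_cons (a, y)).
Proof.
move=> mF F0; have mc := @measurable_rV_cons R n.
have -> : \int[lebesgue_rV R n.+1]_x F x =
    \int[pushforward (lebesgue_measure \x lebesgue_rV R n) (@rV_cons R n)]_x F x by [].
rewrite (ge0_integral_pushforward mc)//=.
rewrite (@fubini_tonelli1 _ _ _ _ _ _ _ (F \o @rV_cons R n)) => [//||z]; last exact: F0.
exact: measurableT_comp.
Qed.

Lemma measurable_affine n (x : 'rV[R]_n) (t : R) :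
  measurable_fun setT (fun y : 'rV[R]_n => x + t *: y)%R.
Proof.
apply: measurable_fun_coorP => i.
under eq_fun do rewrite !mxE.
apply: measurable_funD; first exact: measurable_cst.
by apply: measurable_funM; [exact: measurable_cst|exact: measurable_coor].
Qed.

Lemma rV_cons_affine n (x : 'rV[R]_n.+1) (t a : R) (y : 'rV[R]_n) :
  (x + t *: rV_cons (a, y))%R =
   rV_cons (x ord0 ord0 + t * a, (rV_uncons x).2 + t *: y)%R.
Proof.
by apply/rowP => i; rewrite !mxE; case: (unliftP ord0 i) => [j|] -> //; rewrite !mxE.
Qed.

(** By induction on the dimension: Tonelli splits off one coordinate, and its one-dimensional
    substitution contributes one factor t^-1. *)
Lemma ge0_integral_affine n (x : 'rV[R]_n) (t : R) (F : 'rV[R]_n -> \bar R) : (0 < t)%R ->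
  measurable_fun setT F -> (forall x, 0 <= F x) ->
  \int[lebesgue_rV R n]_y F (x + t *: y)%R = (t ^- n)%:E * \int[lebesgue_rV R n]_y F y.
Proof.
move=> t0; elim: n x F => [|n IHn] x F mF F0.
  rewrite expr0 invr1 mul1e; apply: eq_integral => y _; congr F.
  by apply/rowP => -[].
have mFt : measurable_fun setT (fun y : 'rV[R]_n.+1 => F (x + t *: y)%R).
  by apply: measurableT_comp => //; exact: measurable_affine.
rewrite !ge0_integral_rVS//.
have mc a : measurable_fun setT (fun y => F (rV_cons (a, y))).
  by apply: (measurable_fun_pair2 a (f := F \o @rV_cons R n)); exact: measurableT_comp (@measurable_rV_cons R n).
pose G (b : R) := \int[lebesgue_rV R n]_y F (rV_cons (b, y)).
have mG : measurable_fun setT G.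
  apply: (@measurable_fun_fubini_tonelli_F _ _ _ _ _ _ (F \o @rV_cons R n)) => [|z] //=.
  exact: measurableT_comp (@measurable_rV_cons R n).
have G0 b : 0 <= G b by exact: integral_ge0.
have tn : (0 <= t ^- n)%R by rewrite invr_ge0 exprn_ge0// ltW.
transitivity (\int[lebesgue_measure]_a (fun b => (t ^- n)%:E * G b) (x ord0 ord0 + t * a)%R).
  apply: eq_integral => a _; rewrite /G.
  rewrite -(IHn (rV_uncons x).2 (fun y => F (rV_cons ((x ord0 ord0 + t * a)%R, y))))//.
  by apply: eq_integral => y _; rewrite rV_cons_affine.
rewrite (@ge0_integral_lebesgue_affine _ _ _ (fun b => (t ^- n)%:E * G b))//; last 2 first.
- by apply: emeasurable_funM => //; exact: measurable_cst.
- by move=> b; apply: mule_ge0.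
rewrite ge0_integralZl//.
by rewrite muleA -EFinM -invfM -exprS.
Qed.

Lemma measurable_fun_prod_coor n (p : R -> R) : measurable_fun setT p ->
  measurable_fun setT (fun x : 'rV[R]_n => \prod_i p (x ord0 i))%R.
Proof.
move=> mp; elim: (index_enum _) => [|i s IHs].
  by under eq_fun do rewrite big_nil; exact: measurable_cst.
under eq_fun do rewrite big_cons; apply: measurable_funM => //.
by apply: measurableT_comp => //; exact: measurable_coor.
Qed.

Lemma ge0_integral_prod_coor n (p : R -> R) : measurable_fun setT p ->
  (forall t, 0 <= p t)%R ->
  \int[lebesgue_rV R n]_x (\prod_i p (x ord0 i))%:E =
  (\int[lebesgue_measure]_t (p t)%:E) ^+ n.
Proof.
move=> mp p0; elim: n => [|n IHn].
  under eq_integral do rewrite big_ord0.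
  by rewrite integral_cst// mul1e /= diracT.
have P0 k (x : 'rV[R]_k) : (0 <= \prod_i p (x ord0 i))%R by apply: prodr_ge0.
rewrite ge0_integral_rVS//; last 2 first.
- by apply/measurable_EFinP; exact: measurable_fun_prod_coor.
- by move=> x; rewrite lee_fin.
transitivity (\int[lebesgue_measure]_a ((p a)%:E * (\int[lebesgue_measure]_t (p t)%:E) ^+ n)).
  apply: eq_integral => a _.
  have mP : measurable_fun setT (fun x : 'rV[R]_n => (\prod_i p (x ord0 i))%:E).
    by apply/measurable_EFinP; exact: measurable_fun_prod_coor.
  rewrite -IHn -ge0_integralZl//.
    apply: eq_integral => y _; rewrite big_ord_recl /= mxE unlift_none /= EFinM.
    by congr (_ * _%:E); apply: eq_bigr => i _; rewrite mxE liftK.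
  - by move=> x _; rewrite lee_fin.
  - by rewrite lee_fin.
have mpE : measurable_fun setT (fun t : measurableTypeR R => (p t)%:E) by apply/measurable_EFinP.
have I0 : 0 <= (\int[lebesgue_measure]_t (p t)%:E) ^+ n.
  by apply: expe_ge0; apply: integral_ge0 => t _; rewrite lee_fin.
rewrite expeS; apply: (ge0_integralZr lebesgue_measure measurableT mpE _ I0).
by move=> t _; rewrite lee_fin.
Qed.

End rV_integral.

Section rV_measurable.
Context {R : realType} {n : nat}.
Implicit Types (x y : 'rV[R]_n) (t : R).

Local Notation mu := (lebesgue_rV R n).

Lemma Rintegral_affine x t (h : 'rV[R]_n -> R) : 0 < t ->
  mu.-integrable setT (EFin \o h) ->
  mu.-integrable setT (EFin \o (fun y => h (x + t *: y))) /\
  \int[mu]_y h (x + t *: y) = t ^- n * \int[mu]_y h y.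
Proof.
move=> t0 ih; have mh := measurable_int _ ih.
have mht : measurable_fun setT (EFin \o (fun y => h (x + t *: y))).
  exact: (measurableT_comp mh (measurable_affine x t)).
split.
  apply/integrableP; split => //.
  rewrite (ge0_integral_affine x (F := fun y => `|(h y)%:E|%E))//; last first.
    exact: (@measurableT_comp _ _ _ _ _ _ abse).
  case/integrableP : ih => _ hlt; apply: lte_mul_pinfty => //.
  by rewrite lee_fin invr_ge0 exprn_ge0// ltW.
rewrite /Rintegral integralE [in RHS]integralE.
pose hp := ((EFin \o h)^\+)%E; pose hn := ((EFin \o h)^\-)%E.
have mp : measurable_fun setT hp by exact: measurable_funepos.
have mn : measurable_fun setT hn by exact: measurable_funeneg.
have ip : (\int[mu]_y hp y \is a fin_num)%E.
  exact: (integrable_fin_num measurableT (integrable_funepos measurableT ih)).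
have im : (\int[mu]_y hn y \is a fin_num)%E.
  exact: (integrable_fin_num measurableT (integrable_funeneg measurableT ih)).
transitivity (fine ((t ^- n)%:E * \int[mu]_y hp y - (t ^- n)%:E * \int[mu]_y hn y)%E).
  congr (fine (_ - _)%E).
    rewrite -(ge0_integral_affine x t0 mp); last by move=> y; exact: funepos_ge0.
    by apply: eq_integral => y _; rewrite /hp !funeposE.
  rewrite -(ge0_integral_affine x t0 mn); last by move=> y; exact: funeneg_ge0.
  by apply: eq_integral => y _; rewrite /hn !funenegE.
by rewrite -muleBr ?fin_num_adde_defl ?fin_numN// fineM// fin_numB ip im.
Qed.

Lemma integrableC_affine x t (f : 'rV[R]_n -> R[i]) : 0 < t ->
  integrableC mu f -> integrableC mu (fun y => f (x + t *: y)).
Proof.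
by move=> t0 [fr fi]; split; [case: (Rintegral_affine x t0 fr)|case: (Rintegral_affine x t0 fi)].
Qed.

Lemma integralC_affine x t (f : 'rV[R]_n -> R[i]) : 0 < t -> integrableC mu f ->
  integralC mu (fun y => f (x + t *: y)) = (t ^- n)%:C * integralC mu f.
Proof.
move=> t0 [fr fi]; apply: complex_ext; rewrite ReImE /= mul0r ?subr0 ?addr0.
  by case: (Rintegral_affine x t0 fr).
by case: (Rintegral_affine x t0 fi).
Qed.

Lemma integrableC_shift x (f : 'rV[R]_n -> R[i]) :
  integrableC mu f -> integrableC mu (fun y => f (y + x)).
Proof.
move=> fi; have := integrableC_affine x (@ltr01 R) fi.
by under eq_fun do rewrite scale1r addrC.
Qed.

Lemma integralC_shift x (f : 'rV[R]_n -> R[i]) : integrableC mu f ->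
  integralC mu (fun y => f (y + x)) = integralC mu f.
Proof.
move=> fi; have := integralC_affine x (@ltr01 R) fi.
rewrite expr1n invr1 mul1r => <-; congr (integralC mu _).
by apply/funext => y; rewrite scale1r addrC.
Qed.

Lemma ge0_integral_shift x (F : 'rV[R]_n -> \bar R) :
  measurable_fun setT F -> (forall y, 0 <= F y)%E ->
  (\int[mu]_y F (y + x)%R = \int[mu]_y F y)%E.
Proof.
move=> mF F0; rewrite -[RHS]mul1e.
have := ge0_integral_affine x (@ltr01 R) mF F0; rewrite expr1n invr1 => <-.
by apply: eq_integral => y _; rewrite scale1r addrC.
Qed.

Lemma measurable_dotp (x : 'rV[R]_n) : measurable_fun setT (dotp x).
Proof.
rewrite /dotp; elim: (index_enum _) => [|i s IHs].
  by under eq_fun do rewrite big_nil; exact: measurable_cst.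
under eq_fun do rewrite big_cons; apply: measurable_funD => //.
by apply: measurable_funM; [exact: measurable_cst|exact: measurable_coor].
Qed.

Lemma measurable_dotp2 :
  measurable_fun setT (fun z : 'rV[R]_n * 'rV[R]_n => dotp z.1 z.2).
Proof.
rewrite /dotp; elim: (index_enum _) => [|i s IHs].
  by under eq_fun do rewrite big_nil; exact: measurable_cst.
under eq_fun do rewrite big_cons; apply: measurable_funD => //.
apply: measurable_funM.
  exact: (measurableT_comp (measurable_coor i) measurable_fst).
exact: (measurableT_comp (measurable_coor i) measurable_snd).
Qed.

Lemma measurable_rVB :
  measurable_fun setT (fun z : 'rV[R]_n * 'rV[R]_n => z.1 - z.2).
Proof.
apply: measurable_fun_coorP => i; under eq_fun do rewrite !mxE.
apply: measurable_funB.
  exact: (measurableT_comp (measurable_coor i) measurable_fst).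
exact: (measurableT_comp (measurable_coor i) measurable_snd).
Qed.

Lemma measurable_rVN : measurable_fun setT (fun x : 'rV[R]_n => - x).
Proof.
apply: measurable_fun_coorP => i; under eq_fun do rewrite !mxE.
by apply: measurable_funN; exact: measurable_coor.
Qed.

(* A continuous function is the pointwise limit of its values at the grid points
   [floor ((k + 1) x) / (k + 1)], which range over a countable set. *)
Lemma continuous_measurable_rV (f : 'rV[R]_n -> R) : continuous f -> measurable_fun setT f.
Proof.
move=> cf.
pose pt (k : nat) (z : 'rV[int]_n) : 'rV[R]_n := \row_i ((z ord0 i)%:~R / k.+1%:R).
pose fl (k : nat) (x : 'rV[R]_n) : 'rV[int]_n := \row_i Num.floor (k.+1%:R * x ord0 i).
have mfl k z : measurable [set x | fl k x = z].
  have -> : [set x | fl k x = z] =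
      \bigcap_(i in [set: 'I_n]) ((fun x : 'rV[R]_n => k.+1%:R * x ord0 i) @^-1`
        `[(z ord0 i)%:~R, (z ord0 i + 1)%:~R[).
    apply/seteqP; split => x /= => [<- i _ |H].
      rewrite /= in_itv /= mxE; exact: floor_itv.
    apply/rowP => i; rewrite mxE; apply: floor_def.
    by have := H i I; rewrite /= in_itv /=.
  apply: fin_bigcap_measurable => //= i _.
  rewrite -[X in measurable X]setTI.
  have mc : measurable_fun setT (fun x : 'rV[R]_n => k.+1%:R * x ord0 i).
    by apply: measurable_funM; [exact: measurable_cst|exact: measurable_coor].
  by apply: mc => //; exact: measurable_itv.
have mpt k : measurable_fun setT (fun x => f (pt k (fl k x))).
  move=> _ Y mY; rewrite setTI.
  (* The preimage is the union of the cells [fl k x = z] whose value lies in [Y], enumerated through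
     the codes [j] of integer vectors; other codes contribute the empty set. *)
  have -> : (fun x => f (pt k (fl k x))) @^-1` Y =
      \bigcup_j (if unpickle j is Some z then
        if `[< Y (f (pt k z)) >] then [set x | fl k x = z] else set0 else set0).
    apply/seteqP; split => x /=.
      move=> Yx; exists (pickle (fl k x)) => //; rewrite pickleK.
      by case: asboolP.
    by move=> [j _]; case: unpickle => // z; case: asboolP => // Yz ->.
  apply: bigcupT_measurable => j; case: unpickle => // z.
  by case: asboolP.
apply: (measurable_fun_cvg mpt) => x _.
apply: (cvg_comp (fun k => pt k (fl k x)) f _ (cf x)).
apply/cvgrPdist_le => e e0; near=> k.
have ke : (k.+1%:R : R)^-1 < e by near: k; exact: (near_infty_natSinv_lt (PosNum e0)).
rewrite /Num.norm /= mx_normrE; apply/bigmax_leP; split; first exact: ltW.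
move=> [i j] _ /=; rewrite ord1 !mxE /=.
have k0 : (0 : R) < k.+1%:R by [].
have := floor_itv (k.+1%:R * x ord0 j) => /andP[].
set z := Num.floor _ => zl zr.
apply: le_trans (ltW ke).
have -> : x ord0 j - z%:~R / k.+1%:R = (k.+1%:R * x ord0 j - z%:~R) / k.+1%:R.
  by field; rewrite gt_eqF.
rewrite normrM (@gtr0_norm _ k.+1%:R^-1) ?invr_gt0// ler_piMl ?invr_ge0//.
rewrite ger0_norm ?subr_ge0// lerBlDl; apply: ltW.
by move: zr; rewrite intrD.
Unshelve. all: by end_near. Qed.

End rV_measurable.

(** * The exponential integral *)

Section dot_product.
Context {R : realType} {n : nat}.
Implicit Types (x y v : 'rV[R]_n) (t : R).

Lemma dotpC x y : dotp x y = dotp y x.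
Proof. by apply: eq_bigr => i _; rewrite mulrC. Qed.

Lemma dotpDl x y v : dotp (x + y) v = dotp x v + dotp y v.
Proof. by rewrite -big_split; apply: eq_bigr => i _; rewrite mxE mulrDl. Qed.

Lemma dotpZl t x v : dotp (t *: x) v = t * dotp x v.
Proof. by rewrite mulr_sumr; apply: eq_bigr => i _; rewrite mxE mulrA. Qed.

Lemma dotpNl x v : dotp (- x) v = - dotp x v.
Proof. by rewrite -scaleN1r dotpZl mulN1r. Qed.

Lemma dotp0l v : dotp 0 v = 0.
Proof. by rewrite -(scale0r (0 : 'rV_n)) dotpZl mul0r. Qed.

Lemma dotpDr x y v : dotp v (x + y) = dotp v x + dotp v y.
Proof. by rewrite !(dotpC v) dotpDl. Qed.

Lemma dotpZr t x v : dotp v (t *: x) = t * dotp v x.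
Proof. by rewrite !(dotpC v) dotpZl. Qed.

Lemma dotpNr x v : dotp v (- x) = - dotp v x.
Proof. by rewrite !(dotpC v) dotpNl. Qed.

Lemma dotp_unit i x : dotp (unit_vec R i) x = x ord0 i.
Proof.
rewrite /dotp (bigD1 i)//= big1 ?addr0 => [|j ji].
  by rewrite mxE !eqxx mul1r.
by rewrite mxE eqxx (negbTE ji) mul0r.
Qed.

Lemma dotp_ge0 x : 0 <= dotp x x.
Proof. by apply: sumr_ge0 => i _; rewrite -expr2 sqr_ge0. Qed.

Lemma coor_sqr_le_dotp i x : x ord0 i ^+ 2 <= dotp x x.
Proof.
rewrite /dotp (bigD1 i)//= -expr2 lerDl.
by apply: sumr_ge0 => j _; rewrite -expr2 sqr_ge0.
Qed.

Lemma sqr_japanese x : japanese x ^+ 2 = 1 + dotp x x.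
Proof. by rewrite sqr_sqrtr// addr_ge0// dotp_ge0. Qed.

Lemma japanese_ge1 x : 1 <= japanese x.
Proof. by rewrite -[leLHS]sqrtr1 ler_wsqrtr// lerDl dotp_ge0. Qed.

Lemma japanese_gt0 x : 0 < japanese x.
Proof. exact: lt_le_trans (japanese_ge1 x). Qed.

Lemma coor_le_japanese i x : `|x ord0 i| <= japanese x.
Proof.
rewrite -sqrtr_sqr ler_wsqrtr// (le_trans (coor_sqr_le_dotp i x))//.
by rewrite lerDr.
Qed.

Lemma measurable_japanese : measurable_fun setT (@japanese R n).
Proof.
have ms : measurable_fun setT (@Num.sqrt R).
  by apply: continuous_measurable_fun; exact: sqrt_continuous.
apply: (measurableT_comp ms); apply: measurable_funD; first exact: measurable_cst.
rewrite /dotp; elim: (index_enum _) => [|i s IHs].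
  by under eq_fun do rewrite big_nil; exact: measurable_cst.
under eq_fun do rewrite big_cons; apply: measurable_funD => //.
by apply: measurable_funM; exact: measurable_coor.
Qed.

End dot_product.

(** * The inverse transform: continuity and differentiation under the integral *)

Section cofourier.
Context {R : realType} {n : nat}.
Implicit Types (x y v xi : 'rV[R]_n) (t : R) (g : 'rV[R]_n -> R[i]).

Local Notation mu := (lebesgue_rV R n).

(** This is (2 pi)^n times the inverse Fourier transform. Leaving the constant out makes it
    multiplicative on convolutions and equal to the direct transform up to x -> -x. *)
Definition cofourier g x : R[i] := integralC mu (fun xi => expi (dotp x xi) * g xi).

Lemma fourier_integralE g xi : fourier_integral g xi = cofourier g (- xi).
Proof.
by congr Cintegral; apply/funext => x; rewrite dotpNl dotpC.
Qed.

Lemma Cmeasurable_expi d (T : measurableType d) (h : T -> R) :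
  measurable_fun setT h -> Cmeasurable (fun z => expi (h z)).
Proof.
by move=> mh; split; apply: measurableT_comp mh => //;
  apply: continuous_measurable_fun; [exact: continuous_cos|exact: continuous_sin].
Qed.

Lemma integrableC_expi (m : {measure set 'rV[R]_n -> \bar R}) (h : 'rV[R]_n -> R) g :
  measurable_fun setT h -> integrableC m g -> integrableC m (fun xi => expi (h xi) * g xi).
Proof.
move=> mh gi; apply: (le_integrableC _ (integrable_Cnorm gi)).
  by apply: CmeasurableM; [exact: Cmeasurable_expi|exact: integrableC_measurable gi].
by move=> xi; rewrite CnormM Cnorm_expi mul1r.
Qed.

Lemma integrableC_cofourier g x : integrableC mu g ->
  integrableC mu (fun xi => expi (dotp x xi) * g xi).
Proof. by move=> gi; apply: integrableC_expi => //; exact: measurable_dotp. Qed.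

Lemma Cnorm_cofourier g x : integrableC mu g -> Cnorm (cofourier g x) <= L1norm g.
Proof.
move=> gi; rewrite (le_trans (Cnorm_integralC (integrableC_cofourier x gi)))//.
by under eq_Rintegral do rewrite CnormM Cnorm_expi mul1r.
Qed.

Lemma cofourierD g1 g2 x : integrableC mu g1 -> integrableC mu g2 ->
  cofourier (fun xi => g1 xi + g2 xi) x = cofourier g1 x + cofourier g2 x.
Proof.
move=> i1 i2; rewrite -integralCD; [|exact: integrableC_cofourier..].
by congr integralC; apply/funext => xi; rewrite mulrDr.
Qed.

Lemma cofourierZ z g x : integrableC mu g ->
  cofourier (fun xi => z * g xi) x = z * cofourier g x.
Proof.
move=> i1; rewrite -integralCZ; last exact: integrableC_cofourier.
by congr integralC; apply/funext => xi; rewrite mulrCA.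
Qed.

Lemma cofourierN g x : integrableC mu g ->
  cofourier (fun xi => - g xi) x = - cofourier g x.
Proof.
move=> i1; rewrite -mulN1r -cofourierZ//; congr cofourier.
by apply/funext => xi; rewrite mulN1r.
Qed.

Lemma cofourierB g1 g2 x : integrableC mu g1 -> integrableC mu g2 ->
  cofourier (fun xi => g1 xi - g2 xi) x = cofourier g1 x - cofourier g2 x.
Proof. by move=> i1 i2; rewrite cofourierD ?cofourierN//; exact: integrableCN. Qed.

Lemma cofourier_sum (I : Type) (s : seq I) (u : I -> 'rV[R]_n -> R[i]) x :
  (forall k, integrableC mu (u k)) ->
  cofourier (fun xi => \sum_(k <- s) u k xi) x = \sum_(k <- s) cofourier (u k) x.
Proof.
move=> ui.
rewrite -(integralC_sum _ (u := fun k xi => expi (dotp x xi) * u k xi)); last first.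
  by move=> k; exact: integrableC_cofourier.
by congr integralC; apply/funext => xi; rewrite mulr_sumr.
Qed.

(** Dominated convergence speaks of sequences, so continuity of parameter integrals is reduced to
    sequences. If continuity failed, a bad point chosen in each ball of radius 1/(k+1) would give a
    contradicting sequence. *)
Lemma sequential_continuity_rV (f : 'rV[R]_n -> R) x :
  (forall u : nat -> 'rV[R]_n, u k @[k --> \oo] --> x -> f (u k) @[k --> \oo] --> f x) ->
  f y @[y --> x] --> f x.
Proof.
move=> fs; apply: contrapT => /cvgrPdist_lt.
move=> /existsNP[e /not_implyP[e0 ne]].
have H k : exists y, `|x - y| < k.+1%:R^-1 /\ e <= `|f x - f y|.
  apply: contrapT => nk; apply: ne.
  have k0 : (0 : R) < k.+1%:R^-1 by rewrite invr_gt0.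
  apply/nbhs_ballP; exists (k.+1%:R^-1) => //= y; rewrite mx_norm_ball => xy.
  by rewrite ltNge; apply/negP => ey; apply: nk; exists y.
have [u hu] := choice H.
have ux : u k @[k --> \oo] --> x.
  apply/cvgrPdist_lt => d d0; near=> k.
  apply: lt_trans (hu k).1 _.
  by near: k; exact: (near_infty_natSinv_lt (PosNum d0)).
have /cvgrPdist_lt /(_ e e0) [N _ hN] := fs u ux.
by have := hN N (leqnn N); rewrite ltNge (hu N).2.
Unshelve. all: by end_near. Qed.

Lemma cvg_dotpl (u : nat -> 'rV[R]_n) x v : u k @[k --> \oo] --> x ->
  dotp (u k) v @[k --> \oo] --> dotp x v.
Proof.
move=> ux; rewrite /dotp; elim: (index_enum _) => [|i s IHs].
  by under eq_fun do rewrite big_nil; rewrite big_nil; exact: cvg_cst.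
under eq_fun do rewrite big_cons; rewrite big_cons; apply: cvgD => //.
apply: cvgMr_tmp.
exact: (cvg_comp u _ ux (@coord_continuous _ _ _ _ _ x)).
Qed.

Lemma cvgC_expi (u : nat -> R) t : u k @[k --> \oo] --> t -> cvgC (fun k => expi (u k)) (expi t).
Proof.
move=> ut; split => /=.
  exact: (continuous_cvg _ (@continuous_cos R t) ut).
exact: (continuous_cvg _ (@continuous_sin R t) ut).
Qed.

Lemma cvgC_cofourier g x (u : nat -> 'rV[R]_n) : integrableC mu g ->
  u k @[k --> \oo] --> x -> cvgC (fun k => cofourier g (u k)) (cofourier g x).
Proof.
move=> gi ux; apply: (dominated_convergenceC (h := fun xi => Cnorm (g xi)) _ _ _ _).2.
- by move=> k; exact: integrableC_measurable (integrableC_cofourier _ gi).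
- move=> xi; apply: cvgCM; last exact: cvgC_cst.
  by apply: cvgC_expi; exact: cvg_dotpl.
- exact: integrable_Cnorm.
- by move=> k xi; rewrite CnormM Cnorm_expi mul1r.
Qed.

Lemma Cb0_cofourier g : integrableC mu g -> Cb0 (cofourier g).
Proof.
move=> gi; split; last by exists (L1norm g) => x; exact: Cnorm_cofourier.
split=> x; apply: sequential_continuity_rV => u ux.
  exact: (cvgC_cofourier gi ux).1.
exact: (cvgC_cofourier gi ux).2.
Qed.

(** Differentiation under the integral sign along the line through [x] in direction [v]. As [expi]
    has modulus one, the derivative of the integrand is dominated by |(v . xi) g(xi)| uniformly on
    the line. Only real parts are treated here: the imaginary part of a transform is the real part
    of the transform of -i g. *)
Lemma cvg_Re_cofourier g x v : integrableC mu g ->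
  integrableC mu (fun xi => (0 +i* dotp v xi) * g xi) ->
  h^-1 *: (Re (cofourier g (h *: v + x)) - Re (cofourier g x)) @[h --> 0^'] -->
  Re (cofourier (fun xi => (0 +i* dotp v xi) * g xi) x).
Proof.
move=> gi vgi.
pose f t xi := Re (expi (dotp (t *: v + x) xi) * g xi).
pose f' t xi := Re (expi (dotp (t *: v + x) xi) * ((0 +i* dotp v xi) * g xi)).
have df t xi : is_derive t 1 (f ^~ xi) (f' t xi).
  pose th (s : R) := s * dotp v xi + dotp x xi.
  have thE s : dotp (s *: v + x) xi = th s by rewrite dotpDl dotpZl.
  have -> : f ^~ xi = (Re (g xi) \*: (cos \o th)) - (Im (g xi) \*: (sin \o th)).
    apply/funext => s; rewrite /f ReImE /= thE mulrC [X in _ - X]mulrC.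
    by [].
  rewrite /f' !ReImE /= thE.
  have dth : is_derive t 1 th (dotp v xi).
    have -> : th = (fun s => dotp v xi *: s) \+ cst (dotp x xi).
      by apply/funext => s; rewrite /th /= mulrC.
    by apply: is_derive_eq; rewrite addr0 /= scaler1.
  have dc := is_derive1_comp (is_derive_cos (th t)) dth.
  have ds := is_derive1_comp (is_derive_sin (th t)) dth.
  apply: (is_derive_eq (is_deriveB (is_deriveZ (Re (g xi)) dc) (is_deriveZ (Im (g xi)) ds))).
  by rewrite /GRing.scale /=; ring.
have d1f t xi : partial1of2 f t xi = f' t xi by rewrite /partial1of2 derive1E derive_val.
have I0 : `](-1 : R), 1[%classic 0 by rewrite /= in_itv /= ltrN10 ltr01.
have := @cvg_differentiation_under_integral R _ _ mu f setT measurableT 0 (-1) 1 I0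
  (fun t _ => (integrableC_cofourier (t *: v + x) gi).1)
  (fun t xi _ _ => @ex_derive _ _ _ _ _ _ _ (df t xi))
  (fun xi => Cnorm ((0 +i* dotp v xi) * g xi)) (fun xi => Cnorm_ge0 _)
  (integrable_Cnorm vgi).
have Gub t xi : `|partial1of2 f t xi| <= Cnorm ((0 +i* dotp v xi) * g xi).
  by rewrite d1f (le_trans (Re_le_Cnorm _))// CnormM Cnorm_expi mul1r.
move=> /(_ (fun t xi _ _ => Gub t xi)).
have -> : \int[mu]_xi partial1of2 f 0 xi =
    Re (cofourier (fun xi => (0 +i* dotp v xi) * g xi) x).
  by apply: eq_Rintegral => xi _; rewrite d1f /f' scale0r add0r.
have -> : (fun h : R => h^-1 *: (\int[mu]_xi f (h + 0) xi - \int[mu]_xi f 0 xi)) =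
    (fun h => h^-1 *: (Re (cofourier g (h *: v + x)) - Re (cofourier g x))).
  apply/funext => h; rewrite addr0 /f scale0r add0r.
  by [].
by [].
Qed.

Lemma Im_cofourier g x : integrableC mu g ->
  Im (cofourier g x) = Re (cofourier (fun xi => (0 -i* 1) * g xi) x).
Proof. by move=> gi; rewrite cofourierZ// !ReImE /=; ring. Qed.

Lemma is_derive_cofourier g x v : integrableC mu g ->
  integrableC mu (fun xi => (0 +i* dotp v xi) * g xi) ->
  is_derive x v (@complex.Re R \o cofourier g)
    (Re (cofourier (fun xi => (0 +i* dotp v xi) * g xi) x)) /\
  is_derive x v (@complex.Im R \o cofourier g)
    (Im (cofourier (fun xi => (0 +i* dotp v xi) * g xi) x)).
Proof.
have H g0 : integrableC mu g0 -> integrableC mu (fun xi => (0 +i* dotp v xi) * g0 xi) ->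
    is_derive x v (@complex.Re R \o cofourier g0)
      (Re (cofourier (fun xi => (0 +i* dotp v xi) * g0 xi) x)).
  move=> gi vgi; have c := @cvg_Re_cofourier g0 x v gi vgi.
  by apply: DeriveDef; [apply/cvg_ex; eexists; exact: c|exact: cvg_lim c].
move=> gi vgi; split; first exact: H.
rewrite (Im_cofourier x vgi).
have -> : @complex.Im R \o cofourier g =
    @complex.Re R \o cofourier (fun xi => (0 -i* 1) * g xi).
  by apply/funext => y; exact: (Im_cofourier y gi).
have -> : (fun xi => (0 -i* 1) * ((0 +i* dotp v xi) * g xi)) =
    (fun xi => (0 +i* dotp v xi) * ((0 -i* 1) * g xi)).
  by apply/funext => xi; rewrite mulrCA.
apply: H; first exact: integrableCZ.
under eq_fun do rewrite mulrCA; exact: integrableCZ.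
Qed.

End cofourier.

(** * Schwartz functions *)

Section decay.
Context {R : realType}.

Local Notation weight x := (\prod_i (1 + x ord0 i ^+ 2)^-1).

Lemma weight_gt0 n (x : 'rV[R]_n) : 0 < weight x.
Proof. by apply: prodr_gt0 => i _; rewrite invr_gt0 ltr_pwDl// sqr_ge0. Qed.

(** Each of the n factors 1 + x_i^2 is at most <x>^2. Decay of order 2n in <x> is thereby traded for
    a product whose integral is computed one coordinate at a time. *)
Lemma japanese_weight n (x : 'rV[R]_n) : (japanese x ^+ (2 * n))^-1 <= weight x.
Proof.
rewrite prodfV lef_pV2 ?posrE ?exprn_gt0 ?japanese_gt0//; last first.
  by apply: prodr_gt0 => i _; rewrite ltr_pwDl// sqr_ge0.
rewrite exprM sqr_japanese -[X in _ <= _ ^+ X]card_ord -prodr_const.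
apply: ler_prod => i _; rewrite addr_ge0 ?sqr_ge0//= lerD2l.
exact: coor_sqr_le_dotp.
Qed.

(** The integral factors into n copies of the integral of 1 / (1 + t^2) over the line, which is pi,
    twice its value pi / 2 on the half-line. *)
Lemma integrable_weight n : (lebesgue_rV R n).-integrable setT (EFin \o (fun x => weight x)).
Proof.
have c1 : continuous (fun t : R => (1 + t ^+ 2)^-1).
  exact: (@continuous_oneDsqrV R).
have m1 : measurable_fun setT (fun t : R => (1 + t ^+ 2)^-1).
  exact: continuous_measurable_fun.
have p1 (t : R) : 0 <= (1 + t ^+ 2)^-1 by rewrite invr_ge0 addr_ge0// sqr_ge0.
apply/integrableP; split.
  by apply/measurable_EFinP; exact: measurable_fun_prod_coor m1.
under eq_integral do rewrite /= ger0_norm ?(ltW (weight_gt0 _))//.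
rewrite (ge0_integral_prod_coor n m1 p1).
have -> : (\int[lebesgue_measure]_t ((1 + t ^+ 2)^-1)%:E = pi%:E :> \bar R)%E.
  rewrite ge0_symfun_integralT//; last by move=> t /=; rewrite sqrrN.
  have := integral0y_oneDsqr R; rewrite /oneDsqr set_itvcy => ->.
  by rewrite -EFinM; congr EFin; field.
by rewrite -EFin_expe ltry.
Qed.

Lemma decay_integrableC n (f : 'rV[R]_n -> R[i]) (M : R) : Cmeasurable f ->
  (forall x, japanese x ^+ (2 * n) * Cnorm (f x) <= M) ->
  integrableC (lebesgue_rV R n) f.
Proof.
move=> mf fM.
have jp x : 0 < japanese x ^+ (2 * n) :> R by rewrite exprn_gt0// japanese_gt0.
apply: (le_integrableC mf (integrableRZ M (@integrable_weight n))) => x.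
apply: (@le_trans _ _ (M * (japanese x ^+ (2 * n))^-1)).
  by rewrite ler_pdivlMr// mulrC.
apply: ler_wpM2l (japanese_weight x).
by apply: le_trans (fM x); rewrite mulr_ge0 ?Cnorm_ge0// ltW.
Qed.

End decay.

Section schwartz_functions.
Context {R : realType} {n : nat}.
Implicit Types (phi : 'rV[R]_n -> R[i]) (x v xi : 'rV[R]_n) (i : 'I_n).

Local Notation mu := (lebesgue_rV R n).

Lemma schwartz_partial i phi : schwartz phi -> schwartz (partial i phi).
Proof.
move=> [sphi dphi]; have E s : iter_partial s (partial i phi) = iter_partial (rcons s i) phi.
  by rewrite /iter_partial foldr_rcons.
by split=> s; rewrite E; [exact: sphi|exact: dphi].
Qed.

Lemma schwartz_continuous phi : schwartz phi -> Ccontinuous phi.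
Proof.
move=> [sphi _]; split=> x; apply: differentiable_continuous.
  by have [] := sphi [::] x.
by have [] := sphi [::] x.
Qed.

Lemma Ccontinuous_measurable (f : 'rV[R]_n -> R[i]) : Ccontinuous f -> Cmeasurable f.
Proof. by move=> [cr ci]; split; exact: continuous_measurable_rV. Qed.

Lemma schwartz_integrable phi : schwartz phi -> integrableC mu phi.
Proof.
move=> sphi; have [_ /(_ [::] (2 * n)%N) [M hM]] := sphi.
by apply: decay_integrableC hM; exact/Ccontinuous_measurable/schwartz_continuous.
Qed.

Lemma schwartz_Cb0 phi : schwartz phi -> Cb0 phi.
Proof.
move=> sphi; split; first exact: schwartz_continuous.
have [_ /(_ [::] 0%N) [M hM]] := sphi; exists M => x.
by have := hM x; rewrite expr0 mul1r.
Qed.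

(** Both difference quotients are the same function of [h], so directional derivatives reduce to
    calculus in one variable. *)
Lemma is_derive_line (f : 'rV[R]_n -> R) x v t df :
  is_derive (t *: v + x) v f df <-> is_derive t 1 (fun s : R => f (s *: v + x)) df.
Proof.
have E : (fun h => h^-1 *: ((f \o shift (t *: v + x)) (h *: v) - f (t *: v + x))) =
    (fun h => h^-1 *: (((fun s : R => f (s *: v + x)) \o shift t) (h *: (1 : R)) - f (t *: v + x))).
  apply/funext => h /=; congr (_ *: (f _ - _)).
  by rewrite addrA -scalerDl /GRing.scale /= mulr1.
split=> [[d <-]|[d <-]].
  by apply: DeriveDef; rewrite /derivable /derive /= -?E.
by apply: DeriveDef; rewrite /derivable /derive /= ?E.
Qed.

Lemma schwartz_is_derive i phi x (t : R) : schwartz phi ->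
  is_derive t 1 (fun s : R => Re (phi (s *: unit_vec R i + x)))
    (Re (partial i phi (t *: unit_vec R i + x))) /\
  is_derive t 1 (fun s : R => Im (phi (s *: unit_vec R i + x)))
    (Im (partial i phi (t *: unit_vec R i + x))).
Proof.
move=> [sphi _]; have [dr di] := sphi [::] (t *: unit_vec R i + x).
split.
  apply/(is_derive_line (@complex.Re R \o phi)); apply: DeriveDef => //.
  exact: diff_derivable.
apply/(is_derive_line (@complex.Im R \o phi)); apply: DeriveDef => //.
exact: diff_derivable.
Qed.

Lemma japanese_unit_shift i x (t : R) : `|t| <= 1 ->
  japanese x ^+ 2 <= 3 * japanese (t *: unit_vec R i + x) ^+ 2.
Proof.
move=> t1; rewrite !sqr_japanese !dotpDl !dotpDr !dotpZl !dotpZr (dotpC x) !dotp_unit.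
rewrite !mxE !eqxx.
have := dotp_ge0 x; have := coor_sqr_le_dotp i x.
have : t ^+ 2 <= 1 by rewrite -real_normK ?num_real// expr_le1.
move: (x ord0 i : R) (dotp x x) => /= a b t2 ab b0; rewrite ?mulr1.
(* With a = x_i and b = |x|^2 >= a^2, the right side minus the left side is at least 2 (a + 3 t /
   2)^2 + 2 - 3 t^2 / 2, which is positive for t^2 <= 1. *)
have := sqr_ge0 (t * 3 / 2 + a); rewrite !expr2 in t2 ab *; nra.
Qed.

(* By translation invariance, [\int e^{i xi . x} phi (x + t e_i) dx] equals
   [e^{- i t xi_i} cofourier phi xi]; both sides are differentiated at [t = 0]. *)
Lemma cofourier_partial i phi xi : schwartz phi ->
  cofourier (partial i phi) xi = (0 -i* xi ord0 i) * cofourier phi xi.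
Proof.
move=> sphi; have spphi := schwartz_partial i sphi.
have iphi := schwartz_integrable sphi; have ipphi := schwartz_integrable spphi.
have [M hM] := spphi.2 [::] (2 * n)%N.
set e := unit_vec R i.
have wp x : 0 < \prod_j (1 + x ord0 j ^+ 2)^-1 :> R := @weight_gt0 R n x.
(* One majorant for all |t| <= 1: the inequality <x>^(2n) <= 3^n <x + t e_i>^(2n) turns decay at the
   translated point into decay at x. *)
have bound t x : `|t| <= 1 ->
    Cnorm (partial i phi (t *: e + x)) <= (3 ^+ n * M) * \prod_j (1 + x ord0 j ^+ 2)^-1.
  move=> t1; apply: (@le_trans _ _ (M * 3 ^+ n * (japanese x ^+ (2 * n))^-1)); last first.
    rewrite (mulrC M) ler_wpM2l ?japanese_weight// mulr_ge0//.
    apply: le_trans (hM x); rewrite mulr_ge0 ?Cnorm_ge0// exprn_ge0// ltW// japanese_gt0//.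
  rewrite ler_pdivlMr ?exprn_gt0 ?japanese_gt0//.
  apply: (@le_trans _ _ (Cnorm (partial i phi (t *: e + x)) * (3 * japanese (t *: e + x) ^+ 2) ^+ n)).
    rewrite ler_wpM2l ?Cnorm_ge0// exprM lerXn2r ?nnegrE ?mulr_ge0 ?sqr_ge0 ?exprn_ge0 ?(ltW (japanese_gt0 _))//.
    exact: japanese_unit_shift.
  rewrite exprMn -exprM mulrCA mulrC ler_wpM2r//.
  by rewrite mulrC; exact: hM.
have shiftE t : integralC mu (fun x => expi (dotp xi x) * phi (t *: e + x)) =
    expi (- (t * xi ord0 i)) * cofourier phi xi.
  rewrite /cofourier -(integralC_shift (t *: e) (integrableC_cofourier xi iphi)).
  rewrite -integralCZ; last exact: (integrableC_shift _ (integrableC_cofourier xi iphi)).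
  congr integralC; apply/funext => x.
  rewrite mulrA -expiD (addrC x) dotpDr dotpZr (dotpC xi e) dotp_unit addrA addNr add0r.
  by [].
have ishift t : integrableC mu (fun x => expi (dotp xi x) * phi (t *: e + x)).
  apply: integrableC_expi; first exact: measurable_dotp.
  by under eq_fun do rewrite addrC; exact: integrableC_shift.
have I0 : `](-1 : R), 1[%classic 0 by rewrite /= in_itv /= ltrN10 ltr01.
have Iabs (t : R) : `](-1 : R), 1[%classic t -> `|t| <= 1.
  by rewrite /= in_itv /= => /andP[? ?]; rewrite ler_norml !ltW.
(* Differentiation under the integral concerns real functions, so the identity is proved for real
   parts after multiplication by a number [c] of modulus one; c = 1 and c = -i then give the real
   and the imaginary part. *)
have key (c : R[i]) : Cnorm c = 1 ->
    Re (c * cofourier (partial i phi) xi) = Re (c * ((0 -i* xi ord0 i) * cofourier phi xi)).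
  move=> c1.
  pose f t x := Re (c * (expi (dotp xi x) * phi (t *: e + x))).
  pose f' t x := Re (c * (expi (dotp xi x) * partial i phi (t *: e + x))).
  have df (t : R) x : is_derive t 1 (f ^~ x) (f' t x).
    have [dr di] := schwartz_is_derive i x t sphi.
    pose z := c * expi (dotp xi x).
    have -> : f ^~ x = (Re z \*: (fun s : R => Re (phi (s *: e + x)))) -
        (Im z \*: (fun s : R => Im (phi (s *: e + x)))).
      by apply/funext => s; rewrite /f mulrA -/z ReImE.
    rewrite /f' mulrA -/z ReImE.
    exact: (is_deriveB (is_deriveZ (Re z) dr) (is_deriveZ (Im z) di)).
  have d1f t x : partial1of2 f t x = f' t x by rewrite /partial1of2 derive1E derive_val.
  have G0 x : 0 <= (3 ^+ n * M) * \prod_j (1 + x ord0 j ^+ 2)^-1.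
    apply: le_trans (bound 0 x _); first exact: Cnorm_ge0.
    by rewrite normr0 ler01.
  have := @cvg_differentiation_under_integral R _ _ mu f setT measurableT 0 (-1) 1 I0
    (fun t _ => (integrableCZ c (ishift t)).1)
    (fun t x _ _ => @ex_derive _ _ _ _ _ _ _ (df t x)) _ G0
    (integrableRZ _ (@integrable_weight R n)).
  have Gub (t : R) x : `](-1 : R), 1[%classic t -> setT x ->
      `|partial1of2 f t x| <= (3 ^+ n * M) * \prod_j (1 + x ord0 j ^+ 2)^-1.
    move=> /Iabs t1 _; rewrite d1f (le_trans (Re_le_Cnorm _))// !CnormM c1 Cnorm_expi !mul1r.
    exact: bound.
  move=> /(_ Gub) H1.
  pose F t := Re (c * (expi (- (t * xi ord0 i)) * cofourier phi xi)).
  have FE t : \int[mu]_x f t x = F t.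
    by rewrite /F -shiftE -integralCZ.
  have dF : is_derive (0 : R) 1 F (Re (c * ((0 -i* xi ord0 i) * cofourier phi xi))).
    pose th (s : R) := - (s * xi ord0 i).
    pose z := c * cofourier phi xi.
    have -> : F = (Re z \*: (cos \o th)) - (Im z \*: (sin \o th)).
      by apply/funext => s; rewrite /F mulrCA -/z ReImE /th /= mulrC [X in _ - X]mulrC.
    have dth : is_derive (0 : R) 1 th (- xi ord0 i).
      have -> : th = (fun s => (- xi ord0 i) *: s).
        by apply/funext => s; rewrite /th /GRing.scale /= mulNr mulrC.
      by apply: is_derive_eq; rewrite scaler1.
    have dc := is_derive1_comp (is_derive_cos (th 0)) dth.
    have ds := is_derive1_comp (is_derive_sin (th 0)) dth.
    apply: (is_derive_eq (is_deriveB (is_deriveZ (Re z) dc) (is_deriveZ (Im z) ds))).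
    rewrite mulrCA -/z [RHS]ReM /th /= mul0r oppr0 sin0 cos0 /GRing.scale /=; ring.
  have H2 : h^-1 *: (F (h + 0) - F 0) @[h --> 0^'] -->
      Re (c * ((0 -i* xi ord0 i) * cofourier phi xi)).
    have [/cvg_ex[l hl] <-] := dF.
    have -> : 'D_1 F 0 = l by exact: cvg_lim hl.
    by move: hl => /=; under eq_fun do rewrite /GRing.scale /= mulr1.
  have H1' : h^-1 *: (F (h + 0) - F 0) @[h --> 0^'] --> Re (c * cofourier (partial i phi) xi).
    have -> : Re (c * cofourier (partial i phi) xi) = \int[mu]_x partial1of2 f 0 x.
      rewrite -integralCZ; last exact: integrableC_cofourier.
      by apply: eq_Rintegral => x _; rewrite d1f /f' scale0r add0r.
    by move: H1; under eq_fun do rewrite !FE.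
  exact: (cvg_unique _ H1' H2).
apply: complex_ext.
  have := key 1; rewrite !mul1r; apply.
  exact: ComplexField.Normc.normc1.
have c1 : Cnorm (0 -i* 1 : R[i]) = 1 by rewrite Cnorm_imag normrN normr1.
by have := key _ c1; rewrite !ReM !mul0r !sub0r !mulN1r !opprK.
Qed.

(** Two derivatives in x_j multiply the transform by - xi_j^2, so a factor 1 + xi_j^2 is absorbed by
    adding the bounds for [phi] and for its second derivative in that coordinate. With all
    coordinates in the list this is the decay that makes the transform integrable. *)
Lemma cofourier_decay (s : seq 'I_n) phi : schwartz phi ->
  exists M, forall xi, \prod_(j <- s) (1 + xi ord0 j ^+ 2) * Cnorm (cofourier phi xi) <= M.
Proof.
elim: s phi => [|j s IHs] phi sphi.
  exists (L1norm phi) => xi; rewrite big_nil mul1r.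
  by apply: Cnorm_cofourier; exact: schwartz_integrable.
have [M1 h1] := IHs phi sphi.
have sp := schwartz_partial j sphi.
have [M2 h2] := IHs _ (schwartz_partial j sp).
exists (M1 + M2) => xi; rewrite big_cons mulrC mulrA [_ * (1 + _)]mulrDr mulr1 mulrDl.
apply: lerD; first by rewrite mulrC.
have := h2 xi; rewrite (cofourier_partial _ _ sp) (cofourier_partial _ _ sphi) !CnormM.
have -> : Cnorm (0 -i* xi ord0 j) = `|xi ord0 j| by rewrite Cnorm_imag normrN.
rewrite -[xi ord0 j ^+ 2]real_normK ?num_real//.
by apply: le_trans; rewrite le_eqVlt; apply/orP; left; apply/eqP; ring.
Qed.

End schwartz_functions.

(** * Gaussians *)

Section gaussians.
Context {R : realType} {n : nat}.
Implicit Types (x y v xi : 'rV[R]_n) (i : 'I_n) (a : R).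

Local Notation mu := (lebesgue_rV R n).

Definition gaussian a x : R := expR (- (a * dotp x x)).

(* Real and imaginary parts of the derivatives of [expi (dotp y x) * gaussian a x]. *)
Inductive gauss_span a y : ('rV[R]_n -> R) -> Prop :=
| gauss_cos : gauss_span a y (fun x => cos (dotp y x) * gaussian a x)
| gauss_sin : gauss_span a y (fun x => sin (dotp y x) * gaussian a x)
| gauss_add f g : gauss_span a y f -> gauss_span a y g -> gauss_span a y (fun x => f x + g x)
| gauss_scale c f : gauss_span a y f -> gauss_span a y (fun x => c * f x)
| gauss_coor i f : gauss_span a y f -> gauss_span a y (fun x => x ord0 i * f x).

Lemma differentiable_dotp y x : differentiable (fun x => dotp y x : R) x.
Proof.
rewrite /dotp; elim: (index_enum _) => [|i s IHs].
  by under eq_fun do rewrite big_nil; exact: differentiable_cst.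
under eq_fun do rewrite big_cons; apply: differentiableD => //.
apply: differentiableM; first exact: differentiable_cst.
exact: differentiable_coord.
Qed.

Lemma differentiable_sqdotp x : differentiable (fun x : 'rV[R]_n => dotp x x : R) x.
Proof.
rewrite /dotp; elim: (index_enum _) => [|i s IHs].
  by under eq_fun do rewrite big_nil; exact: differentiable_cst.
under eq_fun do rewrite big_cons; apply: differentiableD => //.
by apply: differentiableM; exact: differentiable_coord.
Qed.

Lemma differentiable_gaussian a x : differentiable (gaussian a) x.
Proof.
apply: (@differentiable_comp _ _ _ _ (fun x => - (a * dotp x x)) expR).
  apply: differentiableN; apply: differentiableM; first exact: differentiable_cst.
  exact: differentiable_sqdotp.
by apply/derivable1_diffP; exact: derivable_expR.
Qed.

Lemma gauss_span_differentiable a y f x : gauss_span a y f -> differentiable f x.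
Proof.
elim=> [||{}f g _ df _ dg|c {}f _ df|i {}f _ df].
- apply: differentiableM (differentiable_gaussian a x).
  apply: (@differentiable_comp _ _ _ _ (dotp y) cos); first exact: differentiable_dotp.
  by apply/derivable1_diffP; exact: derivable_cos.
- apply: differentiableM (differentiable_gaussian a x).
  apply: (@differentiable_comp _ _ _ _ (dotp y) sin); first exact: differentiable_dotp.
  by apply/derivable1_diffP; exact: derivable_sin.
- exact: differentiableD.
- by apply: differentiableM => //; exact: differentiable_cst.
- by apply: differentiableM => //; exact: differentiable_coord.
Qed.

(** The restriction to the line s e_i + x: here p = y_i, q = y . x, r = x_i and w = |x|^2, so the
    exponent contains |s e_i + x|^2 = s^2 + 2 r s + w. *)
Lemma is_derive_gauss_line (p q r w a : R) :
  let E s := expR (- (a * (s * s + 2 * r * s + w))) in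
  is_derive (0 : R) 1 (fun s => cos (s * p + q) * E s)
    (- p * (sin q * E 0) + (- 2 * a) * (r * (cos q * E 0))) /\
  is_derive (0 : R) 1 (fun s => sin (s * p + q) * E s)
    (p * (cos q * E 0) + (- 2 * a) * (r * (sin q * E 0))).
Proof.
move=> E.
pose th (s : R) := s * p + q.
have dth : is_derive (0 : R) 1 th p.
  have -> : th = (p \*: id) + cst q by apply/funext => s; rewrite /th mulrC.
  by apply: is_derive_eq; rewrite addr0 /GRing.scale /= mulr1.
pose u (s : R) := - (a * (s * s + 2 * r * s + w)).
have du : is_derive (0 : R) 1 u (- (a * (2 * r))).
  have -> : u = - (a \*: (id * id + (2 * r) \*: id + cst w)) by [].
  by apply: is_derive_eq; rewrite /GRing.scale /=; ring.
have dE : is_derive (0 : R) 1 E (E 0 * - (a * (2 * r))).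
  exact: (is_derive1_comp (is_derive_expR (u 0)) du).
have dc := is_derive1_comp (is_derive_cos (th 0)) dth.
have ds := is_derive1_comp (is_derive_sin (th 0)) dth.
split.
  apply: (is_derive_eq (is_deriveM dc dE)).
  by rewrite /GRing.scale /= /th mul0r add0r; ring.
apply: (is_derive_eq (is_deriveM ds dE)).
by rewrite /GRing.scale /= /th mul0r add0r; ring.
Qed.

Lemma is_derive_line0 (f : 'rV[R]_n -> R) x v df :
  is_derive (0 : R) 1 (fun s : R => f (s *: v + x)) df -> is_derive x v f df.
Proof. by move=> /is_derive_line; rewrite scale0r add0r. Qed.

Lemma is_derive_gauss a y i x :
  is_derive x (unit_vec R i) (fun x => cos (dotp y x) * gaussian a x)
    (- y ord0 i * (sin (dotp y x) * gaussian a x) +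
     (- 2 * a) * (x ord0 i * (cos (dotp y x) * gaussian a x))) /\
  is_derive x (unit_vec R i) (fun x => sin (dotp y x) * gaussian a x)
    (y ord0 i * (cos (dotp y x) * gaussian a x) +
     (- 2 * a) * (x ord0 i * (sin (dotp y x) * gaussian a x))).
Proof.
have E s : dotp (s *: unit_vec R i + x) (s *: unit_vec R i + x) =
    s * s + 2 * x ord0 i * s + dotp x x.
  rewrite !dotpDl !dotpDr !dotpZl !dotpZr (dotpC x) !dotp_unit !mxE !eqxx /=.
  by ring.
have E' s : dotp y (s *: unit_vec R i + x) = s * y ord0 i + dotp y x.
  by rewrite dotpDr dotpZr (dotpC y (unit_vec R i)) dotp_unit.
have [dc ds] := is_derive_gauss_line (y ord0 i) (dotp y x) (x ord0 i) (dotp x x) a.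
have G0 : gaussian a x = expR (- (a * (0 * 0 + 2 * x ord0 i * 0 + dotp x x))).
  by rewrite /gaussian; congr (expR (- (a * _))); ring.
split; apply: is_derive_line0; rewrite G0.
  by under eq_fun do rewrite /gaussian E E'.
by under eq_fun do rewrite /gaussian E E'.
Qed.

Lemma gauss_span_is_derive a y i f : gauss_span a y f ->
  exists2 f', gauss_span a y f' & forall x, is_derive x (unit_vec R i) f (f' x).
Proof.
elim=> [||{}f g _ [f' sf' df] _ [g' sg' dg]|c {}f _ [f' sf' df]|j {}f sf [f' sf' df]].
- eexists; last by move=> x; exact: (is_derive_gauss a y i x).1.
  by apply: gauss_add; apply: gauss_scale; [exact: gauss_sin|apply: gauss_coor; exact: gauss_cos].
- eexists; last by move=> x; exact: (is_derive_gauss a y i x).2.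
  by apply: gauss_add; apply: gauss_scale; [exact: gauss_cos|apply: gauss_coor; exact: gauss_sin].
- exists (fun x => f' x + g' x); first exact: gauss_add.
  by move=> x; exact: is_deriveD.
- exists (fun x => c * f' x); first exact: gauss_scale.
  by move=> x; exact: (is_deriveZ c (df x)).
- exists (fun x => x ord0 j * f' x + (unit_vec R i) ord0 j * f x).
    by apply: gauss_add; [exact: gauss_coor|exact: gauss_scale].
  move=> x.
  have dj : is_derive x (unit_vec R i) (fun x : 'rV[R]_n => x ord0 j : R) ((unit_vec R i) ord0 j).
    apply: is_derive_line0.
    have -> : (fun s : R => (s *: unit_vec R i + x) ord0 j) =
        ((unit_vec R i) ord0 j \*: id) + cst (x ord0 j).
      by apply/funext => s; rewrite !mxE mulrC.
    by apply: is_derive_eq; rewrite addr0 /GRing.scale /= mulr1.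
  apply: (is_derive_eq (is_deriveM dj (df x))).
  by rewrite /GRing.scale /=; ring.
Qed.

Lemma gaussian_decay a (k : nat) : 0 < a ->
  exists M : R, forall x, japanese x ^+ k * gaussian a x <= M.
Proof.
(* Put z = <x>^2. Then the Gaussian equals e^a e^(- a z), and e^(a z) >= (a z)^(k+1) / (k+1)! by the
   exponential series. The power k is first raised to 2 (k+1), which is allowed because <x> >= 1. *)
move=> a0; exists (expR a * ((k.+1)`!%:R / a ^+ k.+1)) => x.
apply: (@le_trans _ _ (japanese x ^+ (2 * k.+1) * gaussian a x)).
  rewrite ler_wpM2r ?expR_ge0// ler_weXn2l ?japanese_ge1//.
  exact: leq_trans (leqnSn k) (leq_pmull _ _).
rewrite exprM; set z := japanese x ^+ 2.
have z0 : 0 <= z by rewrite sqr_ge0.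
have -> : gaussian a x = expR a * (expR (a * z))^-1.
  rewrite -expRN -expRD /gaussian; congr expR.
  by rewrite /z sqr_japanese; ring.
rewrite mulrCA ler_pM2l ?expR_gt0// ler_pdivrMr ?expR_gt0//.
have ak : 0 < a ^+ k.+1 by rewrite exprn_gt0.
have fk : 0 < (k.+1)`!%:R :> R by rewrite ltr0n fact_gt0.
have := expR_ge1Dxn k (mulr_ge0 (ltW a0) z0).
rewrite exprMn => h.
have -> : z ^+ k.+1 = (k.+1)`!%:R / a ^+ k.+1 * (a ^+ k.+1 * z ^+ k.+1 / (k.+1)`!%:R).
  by field; rewrite !gt_eqF.
rewrite ler_wpM2l ?divr_ge0 ?ltW//.
by apply: lt_le_trans h; rewrite ltrDr.
Qed.

Lemma gauss_span_decay a y f (k : nat) : 0 < a -> gauss_span a y f ->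
  exists M : R, forall x, japanese x ^+ k * `|f x| <= M.
Proof.
move=> a0 sf; elim: sf k => [||{}f g _ df _ dg|c {}f _ df|i {}f _ df] k.
- have [M hM] := gaussian_decay k a0; exists M => x; apply: le_trans (hM x).
  rewrite ler_wpM2l ?exprn_ge0 ?(ltW (japanese_gt0 _))// normrM [`|gaussian _ _|]ger0_norm ?expR_ge0//.
  by rewrite ler_piMl ?expR_ge0// ler_norml cos_geN1 cos_le1.
- have [M hM] := gaussian_decay k a0; exists M => x; apply: le_trans (hM x).
  rewrite ler_wpM2l ?exprn_ge0 ?(ltW (japanese_gt0 _))// normrM [`|gaussian _ _|]ger0_norm ?expR_ge0//.
  by rewrite ler_piMl ?expR_ge0// ler_norml sin_geN1 sin_le1.
- have [M1 h1] := df k; have [M2 h2] := dg k; exists (M1 + M2) => x.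
  apply: le_trans (lerD (h1 x) (h2 x)); rewrite -mulrDr ler_wpM2l ?ler_normD//.
  by rewrite exprn_ge0// ltW// japanese_gt0.
- have [M h] := df k; exists (`|c| * M) => x.
  by rewrite normrM mulrCA ler_wpM2l.
(* Multiplication by a coordinate costs one power of <x>, hence the induction with [k] general. *)
- have [M h] := df k.+1; exists M => x; apply: le_trans (h x).
  rewrite normrM mulrA ler_wpM2r// exprSr ler_wpM2l ?coor_le_japanese//.
  by rewrite exprn_ge0// ltW// japanese_gt0.
Qed.

(** No formula for iterated derivatives is needed: [gauss_span] is stable under each partial
    derivative, and all its members are differentiable and decay faster than any power. *)
Lemma schwartz_gaussian a y : 0 < a ->
  schwartz (fun x => expi (dotp y x) * (gaussian a x)%:C).
Proof.
move=> a0; set phi := (X in schwartz X).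
have S s : gauss_span a y (@complex.Re R \o iter_partial s phi) /\
    gauss_span a y (@complex.Im R \o iter_partial s phi).
  elim: s => [|i s [IHr IHi]].
    have -> : @complex.Re R \o iter_partial [::] phi = (fun x => cos (dotp y x) * gaussian a x).
      by apply/funext => x; rewrite /phi /= ?ReImE /= mulr0 subr0.
    have -> : @complex.Im R \o iter_partial [::] phi = (fun x => sin (dotp y x) * gaussian a x).
      by apply/funext => x; rewrite /phi /= ?ReImE /= mulr0 add0r.
    by split; [exact: gauss_cos|exact: gauss_sin].
  have [fr sr dr] := gauss_span_is_derive i IHr.
  have [fi si di] := gauss_span_is_derive i IHi.
  have -> : @complex.Re R \o iter_partial (i :: s) phi = fr.
    by apply/funext => x; rewrite /= /partial /=; exact: (@derive_val _ _ _ _ _ _ _ (dr x)).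
  have -> : @complex.Im R \o iter_partial (i :: s) phi = fi.
    by apply/funext => x; rewrite /= /partial /=; exact: (@derive_val _ _ _ _ _ _ _ (di x)).
  by [].
split=> [s x|s k].
  by have [sr si] := S s; split; apply: gauss_span_differentiable; [exact: sr|exact: si].
have [sr si] := S s.
have [M1 h1] := gauss_span_decay k a0 sr.
have [M2 h2] := gauss_span_decay k a0 si.
exists (M1 + M2) => x; apply: le_trans (lerD (h1 x) (h2 x)).
rewrite -mulrDr ler_wpM2l ?Cnorm_le_ReIm//.
by rewrite exprn_ge0// ltW// japanese_gt0.
Qed.

End gaussians.

(** * The transform of a Gaussian and Gaussian smoothing *)

Section gaussian_transform.
Context {R : realType} {n : nat}.
Implicit Types (x y v xi : 'rV[R]_n) (a t : R).

Local Notation mu := (lebesgue_rV R n).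

Local Notation gaussC a := (fun x : 'rV[R]_n => (gaussian a x)%:C).

Lemma schwartz_gauss a : 0 < a -> schwartz (gaussC a).
Proof.
move=> a0; have := schwartz_gaussian (0 : 'rV_n) a0.
by under eq_fun do rewrite dotp0l expi0 mul1r.
Qed.

Lemma gaussianN a x : gaussian a (- x) = gaussian a x.
Proof. by rewrite /gaussian dotpNl dotpNr opprK. Qed.

Lemma gaussianZ a t x : gaussian a (t *: x) = gaussian (a * t ^+ 2) x.
Proof. by rewrite /gaussian dotpZl dotpZr; congr (expR (- _)); ring. Qed.

Lemma integral_gaussian a : 0 < a ->
  \int[mu]_x gaussian a x = (Num.sqrt pi / Num.sqrt a) ^+ n.
Proof.
move=> a0; have b0 : 0 < Num.sqrt a by rewrite sqrtr_gt0.
pose p (s : R) := expR (- (a * (s * s))).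
have pE s : p s = gauss_fun (0 + Num.sqrt a * s).
  by rewrite /gauss_fun add0r exprMn sqr_sqrtr ?ltW// expr2.
have cp : continuous p.
  have -> : p = gauss_fun \o (fun s => 0 + Num.sqrt a * s) by apply/funext => s; rewrite pE.
  move=> s; apply: continuous_comp; last exact: continuous_gauss_fun.
  by apply: cvgD; [exact: cvg_cst|apply: cvgMl_tmp; exact: cvg_id].
have mp : measurable_fun setT p by exact: continuous_measurable_fun.
have gE x : gaussian a x = \prod_i p (x ord0 i).
  by rewrite -expR_sum /gaussian mulr_sumr -sumrN.
rewrite /Rintegral; under eq_integral do rewrite gE.
rewrite (ge0_integral_prod_coor n mp) => [|s]; last exact: expR_ge0.
have -> : (\int[lebesgue_measure]_s (p s)%:E = (Num.sqrt pi / Num.sqrt a)%:E :> \bar R)%E.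
  under eq_integral do rewrite pE.
  rewrite (@ge0_integral_lebesgue_affine _ _ _ (fun s => (gauss_fun s)%:E))//.
  - by rewrite integralT_gauss -EFinM mulrC.
  - by apply/measurable_EFinP; exact: measurable_gauss_fun.
  - by move=> s; rewrite lee_fin gauss_fun_ge0.
by rewrite -EFin_expe.
Qed.

Lemma integral_gaussC a : 0 < a ->
  integralC mu (gaussC a) = ((Num.sqrt pi / Num.sqrt a) ^+ n)%:C.
Proof.
move=> a0; rewrite -integral_gaussian//; apply: complex_ext => //=.
by rewrite /Rintegral integral0.
Qed.

Lemma partial_gauss a j x :
  partial j (gaussC a) x = (- 2 * a)%:C * ((x ord0 j)%:C * gaussC a x).
Proof.
have [d _] := is_derive_gauss a (0 : 'rV_n) j x.
have E : (fun x => cos (dotp 0 x) * gaussian a x) = @complex.Re R \o gaussC a.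
  by apply/funext => z; rewrite dotp0l cos0 mul1r.
rewrite E in d; rewrite /partial (@derive_val _ _ _ _ _ _ _ d).
rewrite (_ : @complex.Im R \o gaussC a = cst 0)// derive_cst.
by apply: complex_ext; rewrite ?ReImE /= ?dotp0l ?cos0 ?sin0 ?mxE; ring.
Qed.

(* The Gaussian satisfies [d_j G = - 2 a x_j G], so its transform [E] satisfies
   [d_v E = - (v . eta) / (2 a) E]. *)
Lemma cofourier_gauss_moment a v eta : 0 < a ->
  integrableC mu (fun x => (0 +i* dotp v x) * gaussC a x) /\
  cofourier (fun x => (0 +i* dotp v x) * gaussC a x) eta =
  (- (dotp v eta / (2 * a)))%:C * cofourier (gaussC a) eta.
Proof.
move=> a0; have sG := schwartz_gauss a0.
have a2 : 2 * a != 0 by rewrite mulf_neq0// ?gt_eqF.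
pose c j : R[i] := 0 +i* (- (v ord0 j / (2 * a))).
have E : (fun x => (0 +i* dotp v x) * gaussC a x) =
    (fun x => \sum_(j < n) c j * partial j (gaussC a) x).
  apply/funext => x; under eq_bigr do rewrite partial_gauss !mulrA.
  rewrite -mulr_suml; congr (_ * _); rewrite /dotp.
  rewrite (big_morph (fun t : R => t*i) (id1 := 0) (op1 := +%R)) //; last first.
    by move=> s t; apply: complex_ext; rewrite ReImE /= ?addr0.
  apply: eq_bigr => j _; apply: complex_ext; rewrite !ReImE /=; first ring.
  by field; rewrite gt_eqF.
have ip j : integrableC mu (partial j (gaussC a)).
  by apply: schwartz_integrable; exact: schwartz_partial.
split; first by rewrite E; apply: integrableC_sum => j; exact: integrableCZ.
rewrite E cofourier_sum; last by move=> j; exact: integrableCZ.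
under eq_bigr => j _ do rewrite cofourierZ// cofourier_partial// mulrA.
rewrite -mulr_suml; congr (_ * _); rewrite /dotp.
rewrite mulr_suml -sumrN (big_morph (fun t : R => t%:C) (id1 := 0) (op1 := +%R)) //; last first.
  by move=> s t; apply: complex_ext; rewrite ReImE /= ?addr0.
apply: eq_bigr => j _; apply: complex_ext; rewrite !ReImE /=; last ring.
by field; rewrite gt_eqF.
Qed.

(** Along s -> s xi the transform E satisfies E' = - s |xi|^2 / (2 a) E, so E(s) exp(s^2 |xi|^2 / (4
    a)) is constant. Comparing s = 1 with s = 0, where E is the total mass, gives the formula. *)
Lemma cofourier_gauss a xi : 0 < a ->
  cofourier (gaussC a) xi =
  ((Num.sqrt pi / Num.sqrt a) ^+ n * gaussian (4 * a)^-1 xi)%:C.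
Proof.
move=> a0; have iG := schwartz_integrable (schwartz_gauss a0).
pose b := (4 * a)^-1 * dotp xi xi.
(* [P] stands for the real or the imaginary part; all that is used is that it commutes with real
   factors and that its derivative along the line is known. *)
have Ecst (P : R[i] -> R) : (forall r z, P (r%:C * z) = r * P z) ->
    (forall s : R, is_derive s 1 (fun s => P (cofourier (gaussC a) (s *: xi + 0)))
      (P (cofourier (fun x => (0 +i* dotp xi x) * gaussC a x) (s *: xi + 0)))) ->
    P (cofourier (gaussC a) xi) = expR (- b) * P (cofourier (gaussC a) 0).
  move=> PZ dP.
  pose h s := P (cofourier (gaussC a) (s *: xi + 0)) * expR (b * (s * s)).
  have dh s : is_derive (s : R) 1 h 0.
    pose u (r : R) := b * (r * r).
    have du : is_derive s 1 u (b * (2 * s)).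
      have -> : u = b \*: (id * id) by [].
      by apply: is_derive_eq; rewrite /GRing.scale /=; ring.
    have dE := is_derive1_comp (is_derive_expR (u s)) du.
    apply: (is_derive_eq (is_deriveM (dP s) dE)).
    rewrite (cofourier_gauss_moment _ _ a0).2 PZ addr0 dotpZr /GRing.scale /= /b.
    by field; rewrite gt_eqF.
  have := is_derive_0_is_cst 1 0 dh; rewrite /h scale1r scale0r !addr0 mulr1 mulr0 mulr0 expR0 mulr1.
  by move=> <-; rewrite mulr1 mulrCA -expRD addNr expR0 mulr1.
have dE s := is_derive_cofourier (s *: xi + 0) iG (cofourier_gauss_moment xi 0 a0).1.
have E0 : cofourier (gaussC a) 0 = ((Num.sqrt pi / Num.sqrt a) ^+ n)%:C.
  rewrite -integral_gaussC//; congr integralC; apply/funext => x.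
  by rewrite dotp0l expi0 mul1r.
have gb : expR (- b) = gaussian (4 * a)^-1 xi by [].
apply: complex_ext.
  have ZR (r : R) (z : R[i]) : Re (r%:C * z) = r * Re z by rewrite ReM /= mul0r subr0.
  have DR (s : R) := (is_derive_line (@complex.Re R \o cofourier (gaussC a)) 0 xi s _).1 (dE s).1.
  have -> := Ecst _ ZR DR.
  by rewrite E0 gb /= mulrC.
have ZI (r : R) (z : R[i]) : Im (r%:C * z) = r * Im z by rewrite ImM /= mul0r addr0.
have DI (s : R) := (is_derive_line (@complex.Im R \o cofourier (gaussC a)) 0 xi s _).1 (dE s).2.
have -> := Ecst _ ZI DI.
by rewrite E0 /= mulr0.
Qed.

(** The parameter t^2 / 4 is chosen so that the transform is (2 sqrt(pi) / t)^n exp(- |x - x0|^2 /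
    t^2), a bump of width t around x0. The substitution x = x0 + t y cancels t^n and leaves [t] only
    in the argument of [f]. *)
Lemma gauss_approximation t x0 (f : 'rV[R]_n -> R[i]) : 0 < t -> Cb0 f ->
  integralC mu (fun x => f x * cofourier (gaussC (t ^+ 2 / 4)) (x0 - x)) =
  ((2 * Num.sqrt pi) ^+ n)%:C * integralC mu (fun y => f (x0 + t *: y) * gaussC 1 y).
Proof.
move=> t0 [cf [M fM]].
have a0 : 0 < t ^+ 2 / 4 by rewrite divr_gt0// exprn_gt0.
have mf := Ccontinuous_measurable cf.
pose c : R := (2 * Num.sqrt pi / t) ^+ n.
pose H x := f x * (c%:C * gaussC ((t ^+ 2)^-1) (x - x0)).
have -> : (fun x => f x * cofourier (gaussC (t ^+ 2 / 4)) (x0 - x)) = H.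
  apply/funext => x; rewrite /H cofourier_gauss// -opprB gaussianN; congr (_ * _).
  have -> : (4 * (t ^+ 2 / 4))^-1 = (t ^+ 2)^-1 by congr (_^-1); field.
  have -> : Num.sqrt (t ^+ 2 / 4) = t / 2.
    have -> : t ^+ 2 / 4 = (t / 2) ^+ 2 by field.
    by rewrite sqrtr_sqr ger0_norm// divr_ge0// ltW.
  have -> : Num.sqrt pi / (t / 2) = 2 * Num.sqrt pi / t by field; rewrite gt_eqF.
  by rewrite rmorphM.
have iH : integrableC mu H.
  have ig : integrableC mu (fun x => gaussC ((t ^+ 2)^-1) (x - x0)).
    have tt : 0 < (t ^+ 2)^-1 by rewrite invr_gt0 exprn_gt0.
    exact: (integrableC_shift (- x0) (schwartz_integrable (schwartz_gauss tt))).
  apply: (le_integrableC (h := fun x => M * (`|c| * Cnorm (gaussC ((t ^+ 2)^-1) (x - x0))))).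
  - apply: CmeasurableM => //; apply: CmeasurableM; first exact: Cmeasurable_cst.
    exact: integrableC_measurable ig.
  - by apply: integrableRZ; apply: integrableRZ; exact: integrable_Cnorm.
  - by move=> x; rewrite !CnormM Cnorm_real ler_wpM2r// mulr_ge0// Cnorm_ge0.
have tn0 : t ^+ n != 0 by rewrite expf_neq0// gt_eqF.
have := integralC_affine x0 t0 iH.
have -> : (fun y => H (x0 + t *: y)) = (fun y => c%:C * (f (x0 + t *: y) * gaussC 1 y)).
  apply/funext => y; rewrite /H addrAC subrr add0r gaussianZ mulVf ?expf_neq0 ?gt_eqF//.
  by rewrite mulrCA.
have ify : integrableC mu (fun y => f (x0 + t *: y) * gaussC 1 y).
  have ig := schwartz_integrable (schwartz_gauss (@ltr01 R)).
  apply: (le_integrableC (h := fun x => M * Cnorm (gaussC 1 x))).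
  - apply: CmeasurableM; last exact: integrableC_measurable ig.
    by case: mf => mr mi; split; [apply: (measurableT_comp mr)|apply: (measurableT_comp mi)];
      exact: measurable_affine.
  - by apply: integrableRZ; exact: integrable_Cnorm.
  - by move=> x; rewrite !CnormM ler_wpM2r// Cnorm_ge0.
rewrite integralCZ// => E.
have -> : integralC mu H = (t ^+ n)%:C * ((t ^- n)%:C * integralC mu H).
  by rewrite mulrA -rmorphM mulfV// rmorph1 mul1r.
rewrite -E mulrA -rmorphM; congr (_%:C * _).
by rewrite /c -exprMn; congr (_ ^+ n); field; rewrite gt_eqF.
Qed.

(** The origin of the inversion constant: (2 sqrt(pi))^n comes from the rescaled kernel and
    sqrt(pi)^n is the mass of the Gaussian of parameter 1. *)
Lemma sqrt_pi_sqr : (2 * Num.sqrt pi) ^+ n * (Num.sqrt pi / Num.sqrt 1) ^+ n = (2 * pi) ^+ n :> R.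
Proof.
rewrite -exprMn sqrtr1 divr1 -mulrA -expr2 sqr_sqrtr//.
exact: pi_ge0.
Qed.

(** The smoothing kernel is positive of mass (2 pi)^n, so the bound depends neither on [t] nor on
    [x0]. It supplies the majorant in [integral_Cb0_eq0]. *)
Lemma gauss_approximation_le t x0 (f : 'rV[R]_n -> R[i]) M : 0 < t -> Cb0 f ->
  (forall x, Cnorm (f x) <= M) ->
  Cnorm (integralC mu (fun x => f x * cofourier (gaussC (t ^+ 2 / 4)) (x0 - x))) <=
  (2 * pi) ^+ n * M.
Proof.
move=> t0 cf fM; rewrite gauss_approximation// CnormM Cnorm_real.
have ig := schwartz_integrable (schwartz_gauss (@ltr01 R)).
have ify : integrableC mu (fun y => f (x0 + t *: y) * gaussC 1 y).
  apply: (le_integrableC (h := fun x => M * Cnorm (gaussC 1 x))).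
  - apply: CmeasurableM; last exact: integrableC_measurable ig.
    have [mr mi] := Ccontinuous_measurable cf.1.
    by split; [apply: (measurableT_comp mr)|apply: (measurableT_comp mi)];
      exact: measurable_affine.
  - by apply: integrableRZ; exact: integrable_Cnorm.
  - by move=> x; rewrite !CnormM ler_wpM2r// Cnorm_ge0.
rewrite ger0_norm; last by rewrite exprn_ge0// mulr_ge0// sqrtr_ge0.
rewrite -sqrt_pi_sqr -integral_gaussian// -mulrA ler_wpM2l//.
apply: le_trans (Cnorm_integralC ify) _; rewrite mulrC -RintegralZl//; last first.
  by have := integrable_Cnorm ig; under [X in EFin \o X]eq_fun do rewrite Cnorm_real ger0_norm ?expR_ge0//.
apply: le_Rintegral => //.
- exact: integrable_Cnorm.
- apply: integrableRZ.
  by have := integrable_Cnorm ig; under [X in EFin \o X]eq_fun do rewrite Cnorm_real ger0_norm ?expR_ge0//.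
- by move=> x _; rewrite CnormM Cnorm_real ger0_norm ?expR_ge0// ler_wpM2r ?expR_ge0.
Qed.

Lemma gauss_approximation_cvg (t : nat -> R) x0 (f : 'rV[R]_n -> R[i]) :
  (forall k, 0 < t k) -> t k @[k --> \oo] --> (0 : R) -> Cb0 f ->
  cvgC (fun k => integralC mu (fun x => f x * cofourier (gaussC (t k ^+ 2 / 4)) (x0 - x)))
    (((2 * pi) ^+ n)%:C * f x0).
Proof.
move=> tp t0 cf; have [[cr ci] [M fM]] := cf.
have ig := schwartz_integrable (schwartz_gauss (@ltr01 R)).
have mf := Ccontinuous_measurable cf.1.
have xt y : x0 + t k *: y @[k --> \oo] --> x0.
  have := cvgD (cvg_cst x0) (cvgZr_tmp (a := y) t0); rewrite scale0r addr0; exact.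
under eq_fun do rewrite gauss_approximation//.
have -> : ((2 * pi) ^+ n)%:C * f x0 = ((2 * Num.sqrt pi) ^+ n)%:C *
    integralC mu (fun y => f x0 * gaussC 1 y).
  rewrite integralCZ// integral_gaussC// mulrCA [RHS]mulrC -rmorphM mulrC -sqrt_pi_sqr.
  by rewrite mulrC.
apply: cvgCM; first exact: cvgC_cst.
apply: (dominated_convergenceC (h := fun y => M * Cnorm (gaussC 1 y)) _ _ _ _).2.
- move=> k; apply: CmeasurableM; last exact: integrableC_measurable ig.
  by case: mf => mr mi; split; [apply: (measurableT_comp mr)|apply: (measurableT_comp mi)];
    exact: measurable_affine.
- move=> y; apply: cvgCM; last exact: cvgC_cst.
  split; first exact: (cvg_comp _ _ (xt y) (cr x0)).
  exact: (cvg_comp _ _ (xt y) (ci x0)).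
- by apply: integrableRZ; exact: integrable_Cnorm.
- by move=> k y; rewrite CnormM ler_wpM2r// Cnorm_ge0.
Qed.

End gaussian_transform.

Lemma Cmeasurable_comp d1 d2 (T1 : measurableType d1) (T2 : measurableType d2) (R : realType)
    (f : T2 -> R[i]) (phi : T1 -> T2) :
  Cmeasurable f -> measurable_fun setT phi -> Cmeasurable (fun x => f (phi x)).
Proof. by move=> [fr fi] mphi; split; [exact: (measurableT_comp fr)|exact: (measurableT_comp fi)]. Qed.

(** * Inversion and convolution *)

Section fourier_inversion.
Context {R : realType} {n : nat}.
Implicit Types (x y v xi eta : 'rV[R]_n) (t : R) (f g a b h phi : 'rV[R]_n -> R[i]).

Local Notation mu := (lebesgue_rV R n).
Local Notation gaussC a := (fun x : 'rV[R]_n => (gaussian a x)%:C).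

Lemma L1norm_EFin f : integrableC mu f -> ((L1norm f)%:E = \int[mu]_x (Cnorm (f x))%:E)%E.
Proof.
move=> fi; rewrite /L1norm /Rintegral fineK//.
exact: (integrable_fin_num measurableT (integrable_Cnorm fi)).
Qed.

Lemma measurable_ECnorm d (T : measurableType d) (f : T -> R[i]) : Cmeasurable f ->
  measurable_fun setT (fun z => (Cnorm (f z))%:E).
Proof. by move=> mf; apply/measurable_EFinP; exact: measurable_Cnorm. Qed.

Lemma integrableC_tensor f g (k : 'rV[R]_n * 'rV[R]_n -> R[i]) :
  integrableC mu f -> integrableC mu g -> Cmeasurable k -> (forall z, Cnorm (k z) <= 1) ->
  integrableC (mu \x mu)%E (fun z => k z * (f z.1 * g z.2)).
Proof.
move=> fi gi mk k1.
have mf := integrableC_measurable fi; have mg := integrableC_measurable gi.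
have mF : Cmeasurable (fun z : 'rV[R]_n * 'rV[R]_n => k z * (f z.1 * g z.2)).
  apply: CmeasurableM => //; apply: CmeasurableM.
    exact: (Cmeasurable_comp mf measurable_fst).
  exact: (Cmeasurable_comp mg measurable_snd).
apply: integrableC_prod => //.
apply: (@le_lt_trans _ _ (\int[mu]_x ((Cnorm (f x))%:E * (L1norm g)%:E))%E).
  apply: ge0_le_integral => //.
  - by move=> x _; apply: integral_ge0 => y _; rewrite lee_fin Cnorm_ge0.
  - apply: (@measurable_fun_fubini_tonelli_F _ _ _ _ _ mu (fun z => (Cnorm (k z * (f z.1 * g z.2)))%:E)).
      exact: measurable_ECnorm.
    by move=> z; rewrite lee_fin Cnorm_ge0.
  - by apply: emeasurable_funM; [exact: measurable_ECnorm|exact: measurable_cst].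
  - move=> x _; have mg' := measurable_ECnorm mg.
    rewrite L1norm_EFin// -(ge0_integralZl mu measurableT mg'); last 2 first.
    + by move=> y _; rewrite lee_fin Cnorm_ge0.
    + by rewrite lee_fin Cnorm_ge0.
    apply: ge0_le_integral => //.
    + by move=> y _; rewrite lee_fin Cnorm_ge0.
    + apply: measurable_ECnorm.
      exact: (Cmeasurable_comp (phi := fun y => (x, y)) mF (pair1_measurable x)).
    + by apply: emeasurable_funM; [exact: measurable_cst|exact: measurable_ECnorm].
    + move=> y _; rewrite -EFinM lee_fin !CnormM ler_piMl ?mulr_ge0 ?Cnorm_ge0//.
rewrite ge0_integralZr//.
- by rewrite -L1norm_EFin// -EFinM ltry.
- exact: measurable_ECnorm.
- by move=> x _; rewrite lee_fin Cnorm_ge0.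
- by rewrite lee_fin; apply: Rintegral_ge0 => x _; exact: Cnorm_ge0.
Qed.

(** Both sides are the double integral of f(x) g(xi) exp(i s x . xi). The choice s = 1 serves
    [cofourier], and s = -1 serves [fourier_integral]. *)
Lemma multiplication_formula f g (s : R) : integrableC mu f -> integrableC mu g ->
  integralC mu (fun x => f x * cofourier g (s *: x)) =
  integralC mu (fun xi => g xi * cofourier f (s *: xi)).
Proof.
move=> fi gi.
pose k (z : 'rV[R]_n * 'rV[R]_n) : R[i] := expi (s * dotp z.1 z.2).
have mk : Cmeasurable k.
  apply: Cmeasurable_expi; apply: measurable_funM; first exact: measurable_cst.
  exact: measurable_dotp2.
have k1 z : Cnorm (k z) <= 1 by rewrite Cnorm_expi.
have iF := integrableC_tensor fi gi mk k1.
transitivity (integralC mu (fun x => integralC mu (fun xi => k (x, xi) * (f x * g xi)))).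
  congr integralC; apply/funext => x; rewrite -integralCZ; last exact: integrableC_cofourier.
  by congr integralC; apply/funext => xi; rewrite /k dotpZl/= mulrCA.
rewrite (FubiniC iF); congr integralC; apply/funext => xi.
rewrite -integralCZ; last exact: integrableC_cofourier.
congr integralC; apply/funext => x; rewrite /k dotpZl/= dotpC.
by rewrite [RHS]mulrCA [g xi * _]mulrC.
Qed.

Definition inv_seq (k : nat) : R := k.+1%:R^-1.

Lemma inv_seq_gt0 k : 0 < inv_seq k. Proof. by rewrite invr_gt0. Qed.

Lemma cvg_inv_seq : inv_seq k @[k --> \oo] --> (0 : R).
Proof. exact: cvg_harmonic. Qed.

Lemma cvgC_gauss x : cvgC (fun k => gaussC (inv_seq k ^+ 2 / 4) x) 1.
Proof.
split; last exact: cvg_cst.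
rewrite /= -[X in _ --> X](@expR0 R).
apply: (continuous_cvg _ (@continuous_expR R 0)).
have -> : (0 : R) = - (0 ^+ 2 / 4 * dotp x x) by rewrite expr0n !mul0r oppr0.
apply: cvgN; apply: cvgMr_tmp; apply: cvgMr_tmp; rewrite expr2.
by under eq_fun do rewrite expr2; apply: cvgM; exact: cvg_inv_seq.
Qed.

Lemma gaussian_le1 (c : R) x : 0 <= c -> gaussian c x <= 1.
Proof. by move=> c0; rewrite -[leRHS]expR0 ler_expR oppr_le0 mulr_ge0// dotp_ge0. Qed.

Lemma fourier_modulated_gauss (c : R) x0 x :
  fourier_integral (fun xi => expi (dotp x0 xi) * gaussC c xi) x = cofourier (gaussC c) (x0 - x).
Proof.
rewrite fourier_integralE; congr integralC; apply/funext => xi.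
by rewrite mulrA -expiD -dotpDl addrC.
Qed.

Lemma fourier_inversion f g x0 : Cb0 f -> has_fourier f g ->
  ((2 * pi) ^+ n)%:C * f x0 = cofourier g x0.
Proof.
move=> cf [gi fg].
pose phi k xi := expi (dotp x0 xi) * gaussC (inv_seq k ^+ 2 / 4) xi.
have tp k : 0 < inv_seq k ^+ 2 / 4 by rewrite divr_gt0// exprn_gt0// inv_seq_gt0.
(* The transform of the modulated Gaussian is the kernel centred at [x0], so the defining identity
   of [has_fourier] equates a smoothing of [f] near [x0] with a damped version of the integral
   [cofourier g x0]. *)
have H k : integralC mu (fun x => f x * cofourier (gaussC (inv_seq k ^+ 2 / 4)) (x0 - x)) =
    integralC mu (fun xi => g xi * phi k xi).
  rewrite -[RHS](fg _ (schwartz_gaussian x0 (tp k))); congr integralC.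
  by apply/funext => x; rewrite fourier_modulated_gauss.
have c1 := gauss_approximation_cvg x0 inv_seq_gt0 cvg_inv_seq cf.
apply: (cvgC_unique c1); under eq_fun do rewrite H.
apply: (dominated_convergenceC (h := fun xi => Cnorm (g xi)) _ _ _ _).2.
- move=> k; apply: CmeasurableM; first exact: integrableC_measurable gi.
  exact/Ccontinuous_measurable/schwartz_continuous/schwartz_gaussian.
- move=> xi; rewrite mulrC; apply: cvgCM; first exact: cvgC_cst.
  rewrite -[X in cvgC _ X]mulr1; apply: cvgCM; [exact: cvgC_cst|exact: cvgC_gauss].
- exact: integrable_Cnorm.
- move=> k xi; rewrite !CnormM Cnorm_expi mul1r Cnorm_real ger0_norm ?expR_ge0//.
  by rewrite ler_piMr ?Cnorm_ge0 ?gaussian_le1// ltW.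
Qed.

Lemma schwartz_fourier_integrable phi : schwartz phi -> integrableC mu (fourier_integral phi).
Proof.
move=> sphi; have iphi := schwartz_integrable sphi.
have [M hM] := cofourier_decay (index_enum 'I_n) sphi.
have mc : Cmeasurable (fourier_integral phi).
  have -> : fourier_integral phi = (fun x => cofourier phi (- x)).
    by apply/funext => x; exact: fourier_integralE.
  apply: Cmeasurable_comp measurable_rVN.
  by apply: Ccontinuous_measurable; have [] := Cb0_cofourier iphi.
apply: (le_integrableC mc (integrableRZ M (@integrable_weight R n))) => xi.
rewrite fourier_integralE prodfV ler_pdivlMr; last first.
  by apply: prodr_gt0 => i _; rewrite ltr_pwDl// sqr_ge0.
rewrite mulrC; have := hM (- xi).
by under eq_bigr do rewrite mxE sqrrN.
Qed.

Lemma schwartz_has_fourier phi : schwartz phi -> has_fourier phi (fourier_integral phi).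
Proof.
move=> sphi; have ip := schwartz_integrable sphi.
split; first exact: schwartz_fourier_integrable.
move=> psi spsi; have := multiplication_formula (-1) ip (schwartz_integrable spsi).
have E p : (fun x => cofourier p (-1 *: x)) = fourier_integral p.
  by apply/funext => x; rewrite fourier_integralE scaleN1r.
move=> H; transitivity (integralC mu (fun x => phi x * cofourier psi (-1 *: x))).
  by congr integralC; apply/funext => x; rewrite -E.
rewrite H; congr integralC; apply/funext => x.
by rewrite mulrC -E.
Qed.

(** The multiplication formula moves [cofourier] from [g] onto the transform of the test function,
    where inversion returns (2 pi)^n times the test function. *)
Lemma has_fourier_cofourier g : integrableC mu g ->
  has_fourier (fun x => ((2 * pi) ^- n)%:C * cofourier g x) g.
Proof.
move=> gi; split => // phi sphi.
have iphi := schwartz_integrable sphi; have ihat := schwartz_fourier_integrable sphi.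
have p0 : (2 * pi) ^+ n != 0 :> R by rewrite expf_neq0// gt_eqF// mulr_gt0// pi_gt0.
have := multiplication_formula 1 ihat gi.
under eq_fun do rewrite scale1r; under [in RHS]eq_fun do rewrite scale1r.
move=> H; transitivity (((2 * pi) ^- n)%:C * integralC mu (fun x => fourier_integral phi x * cofourier g x)).
  rewrite -integralCZ.
    by congr integralC; apply/funext => x; rewrite -mulrA [cofourier _ _ * _]mulrC.
  apply: (le_integrableC (h := fun x => L1norm g * Cnorm (fourier_integral phi x))).
  - apply: CmeasurableM; first exact: integrableC_measurable ihat.
    exact: Ccontinuous_measurable (Cb0_cofourier gi).1.
  - by apply: integrableRZ; exact: integrable_Cnorm.
  - by move=> x; rewrite CnormM mulrC ler_wpM2r ?Cnorm_ge0// Cnorm_cofourier.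
have inv xi := fourier_inversion xi (schwartz_Cb0 sphi) (schwartz_has_fourier sphi).
have igp : integrableC mu (fun xi => g xi * phi xi).
  have [_ [M hM]] := schwartz_Cb0 sphi.
  apply: (le_integrableC (h := fun xi => M * Cnorm (g xi))).
  - apply: CmeasurableM; [exact: integrableC_measurable gi|exact: integrableC_measurable iphi].
  - by apply: integrableRZ; exact: integrable_Cnorm.
  - by move=> x; rewrite CnormM mulrC ler_wpM2r ?Cnorm_ge0.
rewrite H; under eq_fun do rewrite -inv mulrCA.
rewrite integralCZ// mulrA -rmorphM mulVf// mul1r.
by [].
Qed.

Definition convolution a b xi : R[i] := integralC mu (fun eta => a (xi - eta) * b eta).

(** With the integral in xi performed first, translation invariance makes the inner integral
    independent of eta and the norms multiply exactly. The same computation gives absolute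
    integrability for Fubini and the L^1 bound for convolutions. *)
Lemma convolution_integrable_prod a b : integrableC mu a -> integrableC mu b ->
  Cmeasurable (fun z : 'rV[R]_n * 'rV[R]_n => a (z.1 - z.2) * b z.2) /\
  (\int[mu]_xi \int[mu]_eta (Cnorm (a (xi - eta) * b eta))%:E = (L1norm a * L1norm b)%:E)%E.
Proof.
move=> ai bi; have ma := integrableC_measurable ai; have mb := integrableC_measurable bi.
have mF : Cmeasurable (fun z : 'rV[R]_n * 'rV[R]_n => a (z.1 - z.2) * b z.2).
  apply: CmeasurableM; first exact: (Cmeasurable_comp ma measurable_rVB).
  exact: (Cmeasurable_comp mb measurable_snd).
split=> //.
rewrite (@fubini_tonelli _ _ _ _ _ mu mu (fun z => (Cnorm (a (z.1 - z.2) * b z.2))%:E)); last 2 first.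
- exact: measurable_ECnorm.
- by move=> z; rewrite lee_fin Cnorm_ge0.
transitivity (\int[mu]_eta ((L1norm a)%:E * (Cnorm (b eta))%:E))%E.
  apply: eq_integral => eta _.
  have mA : measurable_fun setT (fun xi => (Cnorm (a (xi - eta)))%:E).
    apply: measurable_ECnorm; apply: (Cmeasurable_comp ma).
    by have := measurable_affine (- eta) 1; under eq_fun do rewrite scale1r addrC.
  transitivity (\int[mu]_xi ((Cnorm (a (xi - eta)))%:E * (Cnorm (b eta))%:E))%E.
    by apply: eq_integral => xi _; rewrite /= CnormM EFinM.
  rewrite (ge0_integralZr mu measurableT mA); last 2 first.
  - by move=> x _; rewrite lee_fin Cnorm_ge0.
  - by rewrite lee_fin Cnorm_ge0.
  rewrite (ge0_integral_shift (- eta) (F := fun x => (Cnorm (a x))%:E)).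
  - by rewrite -L1norm_EFin.
  - exact: measurable_ECnorm.
  - by move=> x; rewrite lee_fin Cnorm_ge0.
rewrite (ge0_integralZl mu measurableT (measurable_ECnorm mb)).
- by rewrite -L1norm_EFin// EFinM.
- by move=> x _; rewrite lee_fin Cnorm_ge0.
- by rewrite lee_fin; apply: Rintegral_ge0 => x _; exact: Cnorm_ge0.
Qed.

Lemma integrableC_conv_prod a b : integrableC mu a -> integrableC mu b ->
  integrableC (mu \x mu)%E (fun z => a (z.1 - z.2) * b z.2).
Proof.
move=> ai bi; have [mF eF] := convolution_integrable_prod ai bi.
by apply: integrableC_prod => //=; rewrite eF ltry.
Qed.

Lemma integrableC_convolution a b : integrableC mu a -> integrableC mu b ->
  integrableC mu (convolution a b).
Proof. by move=> ai bi; exact: (integrableC_integral2 (integrableC_conv_prod ai bi)). Qed.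

Lemma L1norm_convolution a b : integrableC mu a -> integrableC mu b ->
  L1norm (convolution a b) <= L1norm a * L1norm b.
Proof.
move=> ai bi; have [mF eF] := convolution_integrable_prod ai bi.
have ci := integrableC_convolution ai bi.
rewrite -lee_fin L1norm_EFin// -eF; apply: ge0_le_integral => //.
- by move=> x _; rewrite lee_fin Cnorm_ge0.
- by apply: measurable_ECnorm; exact: integrableC_measurable ci.
- have H : measurable_fun setT (fubini_F mu
      (fun z : 'rV[R]_n * 'rV[R]_n => (Cnorm (a (z.1 - z.2) * b z.2))%:E)).
    apply: measurable_fun_fubini_tonelli_F; first exact: measurable_ECnorm.
    by move=> z; rewrite lee_fin Cnorm_ge0.
  exact: H.
- move=> xi _; apply: ECnorm_integralC.
  exact: (Cmeasurable_comp (phi := fun eta => (xi, eta)) mF (pair1_measurable xi)).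
Qed.

Lemma cofourier_convolution a b x : integrableC mu a -> integrableC mu b ->
  cofourier (convolution a b) x = cofourier a x * cofourier b x.
Proof.
move=> ai bi; have iF := integrableC_conv_prod ai bi.
pose F (z : 'rV[R]_n * 'rV[R]_n) := expi (dotp x z.1) * (a (z.1 - z.2) * b z.2).
have mF := integrableC_measurable iF.
have mG : Cmeasurable F.
  apply: CmeasurableM mF.
  by apply: Cmeasurable_expi; exact: (measurableT_comp (measurable_dotp x) measurable_fst).
have GF z : Cnorm (F z) <= Cnorm (a (z.1 - z.2) * b z.2).
  by rewrite /F CnormM Cnorm_expi mul1r.
have iG := le_integrableC mG (integrable_Cnorm iF) GF.
transitivity (integralC mu (fun xi => integralC mu (fun eta => F (xi, eta)))).
  (* Only almost everywhere: pulling the phase into the inner integral uses integrability in [eta],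
     which Fubini grants for almost every [xi]. *)
  apply: ae_eq_integralC.
  - by apply: integrableC_measurable; apply: integrableC_cofourier; exact: integrableC_convolution.
  - exact: integrableC_measurable (integrableC_integral2 iG).
  - have [/ae_integrable1 hr /ae_integrable1 hi] := iF.
    by apply: filterS2 hr hi => xi hr hi; rewrite -integralCZ.
rewrite (FubiniC iG).
transitivity (integralC mu (fun eta => cofourier a x * (expi (dotp x eta) * b eta))).
  congr integralC; apply/funext => eta; rewrite /F /= /cofourier.
  have ia := integrableC_cofourier x ai.
  rewrite -(integralC_shift (- eta) ia) [RHS]mulrC -integralCZ; last first.
    exact: (integrableC_shift (- eta) ia).
  congr integralC; apply/funext => xi.
  have E : expi (dotp x (- eta)) * expi (dotp x eta) = 1 :> R[i] by rewrite dotpNr expiNK.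
  rewrite dotpDr expiD -[LHS]mulr1 -E.
  by ring.
by rewrite integralCZ//; exact: integrableC_cofourier.
Qed.

End fourier_inversion.

(** * Uniqueness of the Fourier density *)

Section fourier_uniqueness.
Context {R : realType} {n : nat}.
Implicit Types (x y v xi eta : 'rV[R]_n) (t : R) (f g h k : 'rV[R]_n -> R[i]).
Implicit Types b : 'I_n -> R.

Local Notation mu := (lebesgue_rV R n).
Local Notation gaussC a := (fun x : 'rV[R]_n => (gaussian a x)%:C).

(** After exchanging the integrals, the inner one pairs [h] with a translated kernel. That kernel is
    the transform of a modulated Gaussian [psi], so the multiplication formula turns the pairing
    into one of [psi] with [cofourier h], which is zero. *)
Lemma integral_gauss_average h k (c : R) : 0 < c -> integrableC mu h ->
  (forall x, cofourier h x = 0) -> Cb0 k ->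
  integralC mu (fun xi => h xi * integralC mu (fun eta => k eta * cofourier (gaussC c) (xi - eta))) = 0.
Proof.
move=> c0 hi h0 [ck [M kM]]; have sG := schwartz_gauss (n := n) c0.
have iG := schwartz_integrable sG.
have mk := Ccontinuous_measurable ck.
pose q := cofourier (gaussC c).
have iq : integrableC mu q.
  have iE : integrableC mu (fun xi => ((Num.sqrt pi / Num.sqrt c) ^+ n)%:C * gaussC (4 * c)^-1 xi).
    apply: integrableCZ; apply: schwartz_integrable; apply: schwartz_gauss.
    by rewrite invr_gt0 mulr_gt0.
  have -> // : q = (fun xi => ((Num.sqrt pi / Num.sqrt c) ^+ n)%:C * gaussC (4 * c)^-1 xi).
  by apply/funext => xi; rewrite /q cofourier_gauss// rmorphM.
have qN xi : q (- xi) = q xi by rewrite /q !cofourier_gauss// gaussianN.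
have iF := integrableC_conv_prod iq hi.
pose F (z : 'rV[R]_n * 'rV[R]_n) := k z.1 * (q (z.1 - z.2) * h z.2).
have mF : Cmeasurable F.
  apply: CmeasurableM (integrableC_measurable iF).
  exact: (Cmeasurable_comp mk measurable_fst).
have FM z : Cnorm (F z) <= M * Cnorm (q (z.1 - z.2) * h z.2).
  by rewrite /F CnormM ler_wpM2r ?Cnorm_ge0.
have iFF := le_integrableC mF (integrableRZ M (integrable_Cnorm iF)) FM.
have ikq xi : integrableC mu (fun eta => k eta * q (xi - eta)).
  have iqs : integrableC mu (fun eta => q (xi - eta)).
    have := integrableC_shift (- xi) iq.
    by under eq_fun do rewrite -qN opprB.
  apply: (le_integrableC (h := fun eta => M * Cnorm (q (xi - eta)))).
  - by apply: CmeasurableM => //; exact: (integrableC_measurable iqs).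
  - by apply: integrableRZ; exact: integrable_Cnorm.
  - by move=> eta; rewrite CnormM ler_wpM2r ?Cnorm_ge0.
transitivity (integralC mu (fun xi => integralC mu (fun eta => F (eta, xi)))).
  congr integralC; apply/funext => xi; rewrite -integralCZ//.
  by congr integralC; apply/funext => eta; rewrite /F /= -(qN (eta - xi)) opprB /q; ring.
rewrite -(FubiniC iFF) -[RHS](@integralC0 _ _ _ mu); congr integralC.
apply/funext => eta; rewrite /cst.
pose psi xi := expi (dotp (- eta) xi) * gaussC c xi.
have ipsi : integrableC mu psi by exact: integrableC_cofourier.
have psiE xi : cofourier psi xi = q (xi - eta).
  by congr integralC; apply/funext => x; rewrite /psi mulrA -expiD -dotpDl.
have := multiplication_formula 1 hi ipsi.
under eq_fun do rewrite scale1r psiE; under [in RHS]eq_fun do rewrite h0 mulr0.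
rewrite (_ : integralC mu (fun=> 0) = 0); last exact: integralC0.
have ihq : integrableC mu (fun xi => h xi * q (xi - eta)).
  have qb := Cnorm_cofourier (g := gaussC c) _ iG.
  apply: (le_integrableC (h := fun xi => L1norm (gaussC c) * Cnorm (h xi))).
  - apply: CmeasurableM; first exact: integrableC_measurable hi.
    exact: integrableC_measurable (integrableC_shift (- eta) iq).
  - by apply: integrableRZ; exact: integrable_Cnorm.
  - by move=> xi; rewrite CnormM mulrC ler_wpM2r ?Cnorm_ge0.
move=> H; transitivity (integralC mu (fun xi => k eta * (h xi * q (xi - eta)))).
  by congr integralC; apply/funext => xi; rewrite /F /= -opprB qN [q _ * _]mulrC.
by rewrite integralCZ// H mulr0.
Qed.

(** The Gaussian smoothings of [k] pair to zero with [h], tend pointwise to (2 pi)^n k and stay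
    below (2 pi)^n M, so dominated convergence applies. *)
Lemma integral_Cb0_eq0 h k : integrableC mu h -> (forall x, cofourier h x = 0) ->
  Cb0 k -> integralC mu (fun xi => h xi * k xi) = 0.
Proof.
move=> hi h0 ck; have [M kM] := ck.2.
have tp j : 0 < inv_seq j ^+ 2 / 4 :> R by rewrite divr_gt0// exprn_gt0// inv_seq_gt0.
pose K j xi := integralC mu (fun eta => k eta * cofourier (gaussC (inv_seq j ^+ 2 / 4)) (xi - eta)).
have K0 j : integralC mu (fun xi => h xi * K j xi) = 0 by exact: integral_gauss_average.
have c0 := @cvgC_cst R 0.
have mh := integrableC_measurable hi.
have mK j : Cmeasurable (K j).
  have mk := Ccontinuous_measurable ck.1.
  (* In the rescaled form [xi] enters only through the continuous function [k], so [K j] is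
     continuous and thus measurable. *)
  have -> : K j = (fun xi => ((2 * Num.sqrt pi) ^+ n)%:C *
      integralC mu (fun y => k (xi + inv_seq j *: y) * gaussC 1 y)).
    by apply/funext => xi; rewrite /K gauss_approximation ?inv_seq_gt0.
  apply: CmeasurableM; first exact: Cmeasurable_cst.
  have iG := schwartz_integrable (schwartz_gauss (n := n) (@ltr01 R)).
  apply: Ccontinuous_measurable.
  have H xi (u : nat -> 'rV[R]_n) : u l @[l --> \oo] --> xi ->
      cvgC (fun l => integralC mu (fun y => k (u l + inv_seq j *: y) * gaussC 1 y))
        (integralC mu (fun y => k (xi + inv_seq j *: y) * gaussC 1 y)).
    move=> uxi; apply: (dominated_convergenceC (h := fun y => M * Cnorm (gaussC 1 y)) _ _ _ _).2.
    - move=> l; apply: CmeasurableM; last exact: integrableC_measurable iG.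
      exact: (Cmeasurable_comp mk (measurable_affine _ _)).
    - move=> y; apply: cvgCM; last exact: cvgC_cst.
      have cu : u l + inv_seq j *: y @[l --> \oo] --> xi + inv_seq j *: y.
        by apply: cvgD => //; exact: cvg_cst.
      split; first exact: (cvg_comp _ _ cu (ck.1.1 _)).
      exact: (cvg_comp _ _ cu (ck.1.2 _)).
    - by apply: integrableRZ; exact: integrable_Cnorm.
    - by move=> l y; rewrite CnormM ler_wpM2r ?Cnorm_ge0.
  by split=> xi; apply: sequential_continuity_rV => u uxi; [exact: (H xi u uxi).1|exact: (H xi u uxi).2].
have := (dominated_convergenceC (m := mu) (u := fun j xi => h xi * K j xi)
  (f := fun xi => h xi * (((2 * pi) ^+ n)%:C * k xi))
  (h := fun xi => ((2 * pi) ^+ n * M) * Cnorm (h xi)) _ _ _ _).2.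
move=> /(_ (fun j => CmeasurableM mh (mK j))) H.
have ihk : integrableC mu (fun xi => h xi * k xi).
  apply: (le_integrableC (h := fun xi => M * Cnorm (h xi))).
  - by apply: CmeasurableM => //; exact: Ccontinuous_measurable ck.1.
  - by apply: integrableRZ; exact: integrable_Cnorm.
  - by move=> xi; rewrite CnormM mulrC ler_wpM2r ?Cnorm_ge0.
have {}H : cvgC (fun j => integralC mu (fun xi => h xi * K j xi))
    (integralC mu (fun xi => h xi * (((2 * pi) ^+ n)%:C * k xi))).
  apply: H.
  - move=> xi; apply: cvgCM; first exact: cvgC_cst.
    exact: (gauss_approximation_cvg xi inv_seq_gt0 cvg_inv_seq ck).
  - by apply: integrableRZ; exact: integrable_Cnorm.
  - move=> j xi; rewrite CnormM mulrC ler_wpM2r ?Cnorm_ge0//.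
    by apply: gauss_approximation_le => //; exact: inv_seq_gt0.
move: H; under eq_fun do rewrite K0.
move=> /(cvgC_unique c0) /esym H.
have p0 : (2 * pi) ^+ n != 0 :> R by rewrite expf_neq0// gt_eqF// mulr_gt0// pi_gt0.
have pC : ((2 * pi) ^+ n)%:C != 0 :> R[i] by rewrite fmorph_eq0.
apply/eqP; rewrite -(mulrI_eq0 _ (mulfI pC)) -integralCZ//; apply/eqP.
by rewrite -[RHS]H; congr integralC; apply/funext => xi; rewrite mulrCA.
Qed.

(** Closed orthants combine what the next steps need: they generate the measurable sets, they are
    stable under intersection, and their indicators are limits of bounded continuous functions. *)
Definition orthant b : set 'rV[R]_n := [set x | forall i, b i <= x ord0 i].

Lemma measurable_orthant b : measurable (orthant b).
Proof.
have -> : orthant b = \bigcap_(i in [set: 'I_n]) ((fun x : 'rV[R]_n => x ord0 i) @^-1` `[b i, +oo[).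
  apply/seteqP; split => x /= H => [i _|i]; first by rewrite /= in_itv /= H.
  by have := H i I; rewrite /= in_itv /= andbT.
apply: fin_bigcap_measurable => //= i _.
rewrite -[X in measurable X]setTI.
by apply: measurable_coor => //; exact: measurable_itv.
Qed.

Lemma measurable_orthantE : @measurable _ 'rV[R]_n = <<s [set A | exists b, A = orthant b] >>.
Proof.
set G := [set A | _]; rewrite eqEsubset; split; last first.
  apply: smallest_sub; first exact: sigma_algebra_measurable.
  by move=> _ [b ->]; exact: measurable_orthant.
have mcoor (i : 'I_n) (B : set (measurableTypeR R)) : measurable B ->
    <<s G >> ((fun x : 'rV[R]_n => x ord0 i) @^-1` B).
  move=> mB; pose c (x : g_sigma_algebraType G) : measurableTypeR R := (x : 'rV[R]_n) ord0 i.
  have mc : measurable_fun setT c.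
    apply: (measurability _ (RGenCInfty.measurableE R)) => _ [_ [s ->] <-].
    rewrite setTI.
    (* The half-space x_i >= s is exhausted by orthants whose other bounds are -m; a given point is
       reached once m exceeds the sum of its |x_j|. *)
    have -> : c @^-1` `[s, +oo[ = \bigcup_m orthant (fun j => if j == i then s else - m%:R).
      apply/seteqP; split => x /=; last first.
        by move=> [m _ /(_ i)]; rewrite eqxx in_itv /= andbT.
      rewrite in_itv /= andbT => sx.
      exists (Num.bound (\sum_j `|(x : 'rV[R]_n) ord0 j|)) => // j.
      case: ifPn => [/eqP -> //|_]; rewrite lerNl (le_trans (ler_norm _))// normrN.
      have S0 : 0 <= \sum_j `|(x : 'rV[R]_n) ord0 j| by apply: sumr_ge0.
      apply: le_trans (ltW (archi_boundP S0)).
      by rewrite (bigD1 j)//= lerDl; apply: sumr_ge0.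
    apply: bigcupT_measurable => m; apply: sub_sigma_algebra.
    by eexists.
  by have := mc measurableT B mB; rewrite setTI.
rewrite /measurable /= /g_sigma_preimage; apply: smallest_sub; first exact: smallest_sigma_algebra.
have : forall i, preimage_set_system setT (fun x : 'rV[R]_n => x ord0 i) measurable `<=` <<s G >>.
  by move=> i _ [B mB <-]; rewrite setTI; exact: mcoor.
move=> H; elim: (index_enum _) => [|i s IHs]; first by rewrite big_nil.
by rewrite big_cons subUset; split.
Qed.

Lemma integral_orthant_eq0 h b : integrableC mu h ->
  (forall k, Cb0 k -> integralC mu (fun xi => h xi * k xi) = 0) ->
  integralC mu (fun xi => h xi * (\1_(orthant b) xi)%:C) = 0.
Proof.
move=> hi hk.
(* [D] is nonnegative and vanishes exactly on the orthant, so the continuous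
   functions [expR (- D) ^+ m] tend to its indicator. *)
pose D (x : 'rV[R]_n) : R := \sum_i (`|b i - x ord0 i| + (b i - x ord0 i)).
have D0 (s : R) : 0 <= `|s| + s by rewrite -lerBlDr sub0r -normrN ler_norm.
have Dge0 x : 0 <= D x by apply: sumr_ge0.
have cD : continuous D.
  move=> x; apply: sequential_continuity_rV => u ux; rewrite /D.
  elim: (index_enum _) => [|i s IHs].
    by under eq_fun do rewrite big_nil; rewrite big_nil; exact: cvg_cst.
  under eq_fun do rewrite big_cons; rewrite big_cons; apply: cvgD => //.
  have ci : (b i - u l ord0 i) @[l --> \oo] --> b i - x ord0 i.
    apply: cvgB; first exact: cvg_cst.
    exact: (cvg_comp u _ ux (@coord_continuous _ _ _ _ _ x)).
  by apply: cvgD => //; exact: cvg_norm.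
pose k m (x : 'rV[R]_n) : R := expR (- D x) ^+ m.
have e1 x : `|expR (- D x)| <= 1.
  by rewrite ger0_norm ?expR_ge0// -[leRHS]expR0 ler_expR oppr_le0.
have ck m : Cb0 (fun x => (k m x)%:C).
  split; last by exists 1 => x; rewrite Cnorm_real /k normrX exprn_ile1.
  split; move=> x; apply: sequential_continuity_rV => u ux; last exact: cvg_cst.
  have cDu : - D (u l) @[l --> \oo] --> - D x by apply: cvgN; exact: (cvg_comp u _ ux (cD x)).
  have ce : expR (- D (u l)) @[l --> \oo] --> expR (- D x).
    exact: (continuous_cvg _ (@continuous_expR R _) cDu).
  rewrite /comp /= /k; elim: m => [|m IHm].
    by under eq_fun do rewrite expr0; rewrite expr0; exact: cvg_cst.
  by under eq_fun do rewrite exprS; rewrite exprS; exact: (cvgM ce IHm).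
have cvgk x : k m x @[m --> \oo] --> (\1_(orthant b) x : R).
  rewrite indicE; have [/set_mem xb|/negP xb] := boolP (x \in orthant b).
    have -> : k ^~ x = cst 1.
      apply/funext => m; rewrite /k (_ : D x = 0) ?oppr0 ?expR0 ?expr1n//.
      rewrite /D big1// => i _; rewrite distrC ger0_norm ?subr_ge0 ?xb//.
      by rewrite -opprB addNr.
    exact: cvg_cst.
  apply: cvg_expr; rewrite ger0_norm ?expR_ge0// -[ltRHS]expR0 ltr_expR oppr_lt0.
  have [i xi] : exists i, x ord0 i < b i.
    apply: contrapT => H; apply: xb; apply/mem_set => i.
    by rewrite leNgt; apply/negP => xi; apply: H; exists i.
  rewrite /D (bigD1 i)//= ltr_pwDl//; last by apply: sumr_ge0.
  by rewrite addr_gt0// ?normr_gt0 ?gt_eqF ?subr_gt0.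
have mh := integrableC_measurable hi.
have H := (dominated_convergenceC (m := mu) (u := fun m xi => h xi * (k m xi)%:C)
  (f := fun xi => h xi * (\1_(orthant b) xi)%:C) (h := fun xi => Cnorm (h xi)) _ _ _ _).2.
apply/esym; apply: (cvgC_unique (@cvgC_cst R 0)).
have -> : (fun=> 0) = (fun m => integralC mu (fun xi => h xi * (k m xi)%:C)).
  by apply/funext => m; rewrite hk.
apply: H.
- by move=> m; apply: CmeasurableM => //; exact: Ccontinuous_measurable (ck m).1.
- move=> xi; apply: cvgCM; first exact: cvgC_cst.
  by split; [exact: cvgk|exact: cvg_cst].
- exact: integrable_Cnorm.
- move=> m xi; rewrite CnormM ler_piMr ?Cnorm_ge0// Cnorm_real /k normrX exprn_ile1//.
Qed.

(** The sets over which [r] integrates to zero form a Dynkin system; the vanishing total integral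
    handles the whole space and complements. Orthants form a pi-system, the intersection having the
    coordinatewise maximum as corner. *)
Lemma ae_eq0_of_orthant (r : 'rV[R]_n -> R) : mu.-integrable setT (EFin \o r) ->
  \int[mu]_x r x = 0 -> (forall b, \int[mu]_x (r x * \1_(orthant b) x) = 0) ->
  {ae mu, forall x, r x = 0}.
Proof.
move=> ir r0 rb; have mr := measurable_int _ ir.
have iS S : measurable S -> mu.-integrable S (EFin \o r).
  by move=> mS; apply: integrableS ir.
have fS S : measurable S -> (\int[mu]_(x in S) (r x)%:E \is a fin_num)%E.
  by move=> mS; exact: (integrable_fin_num mS (iS S mS)).
have P S : measurable S -> (\int[mu]_(x in S) (r x)%:E = 0)%E.
  rewrite measurable_orthantE.
  apply: (dynkin_induction (P := fun S => (\int[mu]_(x in S) (r x)%:E = 0)%E)).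
  - exact: measurable_orthantE.
  - move=> _ _ [b1 ->] [b2 ->]; exists (fun i => Num.max (b1 i) (b2 i)).
    apply/seteqP; split => x /= => [[h1 h2] i|H]; first by rewrite ge_max h1 h2.
    by split=> i; have := H i; rewrite ge_max => /andP[].
  - by rewrite -(fineK (fS _ measurableT)); congr EFin; exact: r0.
  - move=> _ [b ->]; rewrite -(fineK (fS _ (measurable_orthant b))); congr EFin.
    rewrite integral_mkcond -[RHS](rb b); congr fine; apply: eq_integral => x _.
    by rewrite patchE indicE; case: ifP => _; rewrite ?mulr1 ?mulr0.
  - move=> A mA A0.
    have := integral_setU mu mA (measurableC mA) (f := EFin \o r).
    rewrite setUv A0 add0e => <-//; last exact/disj_setPCl.
    by rewrite -(fineK (fS _ measurableT)); congr EFin; exact: r0.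
  - move=> F mF tF F0; rewrite integral_bigcup//; last by apply: iS; exact: bigcupT_measurable.
    by rewrite eseries0.
have := integral_ae_eq (mu := mu) measurableT (g := cst 0%E) (f := EFin \o r) ir.
move=> /(_ (measurable_cst _)) H.
have : ae_eq mu setT (EFin \o r) (cst 0%E).
  by apply: H => S _ mS; rewrite P// integral0.
by apply: filterS => x /(_ I) [].
Qed.

Lemma cofourier_eq0 h : integrableC mu h -> (forall x, cofourier h x = 0) ->
  {ae mu, forall x, h x = 0}.
Proof.
move=> hi h0; have hk k := @integral_Cb0_eq0 h k hi h0.
have ho b := integral_orthant_eq0 b hi hk.
have hT : integralC mu h = 0.
  rewrite -(h0 0); congr integralC; apply/funext => xi.
  by rewrite dotp0l expi0 mul1r.
have rr : {ae mu, forall x, Re (h x) = 0}.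
  apply: ae_eq0_of_orthant; [exact: hi.1|by have /(congr1 (@complex.Re R)) := hT|move=> b].
  have /(congr1 (@complex.Re R)) /= := ho b.
  by under eq_Rintegral do rewrite ReM /= mulr0 subr0.
have ri : {ae mu, forall x, Im (h x) = 0}.
  apply: ae_eq0_of_orthant; [exact: hi.2|by have /(congr1 (@complex.Im R)) := hT|move=> b].
  have /(congr1 (@complex.Im R)) /= := ho b.
  by under eq_Rintegral do rewrite ImM /= mulr0 add0r.
by apply: filterS2 rr ri => x hr hi0; apply: complex_ext; rewrite ?hr ?hi0.
Qed.

End fourier_uniqueness.

(** * The Neumann series *)

Section L1_series.
Context d (T : measurableType d) (R : realType) (m : {measure set T -> \bar R}).
Implicit Types (x : T) (g S : T -> R[i]) (W : nat -> T -> R[i]).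

Lemma summable_cvgC (u : nat -> R[i]) : (\sum_(0 <= k <oo) (Cnorm (u k))%:E < +oo)%E ->
  exists a, cvgC (fun N => \sum_(0 <= k < N) u k) a.
Proof.
move=> ulty; have cN := nnseries_is_cvg (fun k => Cnorm_ge0 (u k)) ulty.
have H (P : R[i] -> R) : (forall z, `|P z| <= Cnorm z) -> cvgn (series (fun k => P (u k))).
  move=> Pz; apply: normed_cvg.
  by apply: series_le_cvg cN => k /=; [exact: normr_ge0|exact: Cnorm_ge0|exact: Pz].
have E (P : R[i] -> R) : {morph P : a b / a + b} -> P 0 = 0 ->
    (fun N => P (\sum_(0 <= k < N) u k)) = series (fun k => P (u k)).
  by move=> PD P0; apply/funext => N; rewrite (big_morph P PD P0).
exists (limn (series (fun k => Re (u k))) +i* limn (series (fun k => Im (u k)))).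
split => /=.
  by rewrite (E _ (@ReD R))//; exact: (H _ (@Re_le_Cnorm R)).
by rewrite (E _ (@ImD R))//; exact: (H _ (@Im_le_Cnorm R)).
Qed.

(** The sum G of the |W k| has integral at most [B] and dominates all partial sums. The conclusion
    is phrased with bounded multipliers [g] because the sum is only ever tested against exp(i x .
    xi) and exp(i x . xi) / <xi>^2. *)
Lemma L1_series_cvg W (B : R) : (forall k, integrableC m (W k)) ->
  (forall N, \sum_(0 <= k < N) \int[m]_x Cnorm (W k x) <= B) ->
  exists S, [/\ integrableC m S, \int[m]_x Cnorm (S x) <= B &
    forall g, Cmeasurable g -> (forall x, Cnorm (g x) <= 1) ->
      cvgC (fun N => \sum_(0 <= k < N) integralC m (fun x => g x * W k x))
           (integralC m (fun x => g x * S x))].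
Proof.
move=> iW WB.
pose G x := (\sum_(0 <= k <oo) (Cnorm (W k x))%:E)%E.
have mN k : measurable_fun setT (fun x => (Cnorm (W k x))%:E).
  by apply: measurable_ECnorm; exact: integrableC_measurable (iW k).
have G0 x : (0 <= G x)%E by apply: nneseries_ge0 => k _ _; rewrite lee_fin Cnorm_ge0.
have mG : measurable_fun setT G.
  apply: (emeasurable_fun_cvg (fun N x => \sum_(0 <= k < N) (Cnorm (W k x))%:E)%E).
    by move=> N; apply: emeasurable_sum => k; exact: mN.
  by move=> x _; apply: is_cvg_nneseries => k _ _; rewrite lee_fin Cnorm_ge0.
have GB : (\int[m]_x G x <= B%:E)%E.
  rewrite integral_nneseries//; last by move=> k x _; rewrite lee_fin Cnorm_ge0.
  have IE k : (\int[m]_x (Cnorm (W k x))%:E = (\int[m]_x Cnorm (W k x))%:E)%E.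
    by rewrite /Rintegral fineK//; exact: (integrable_fin_num measurableT (integrable_Cnorm (iW k))).
  apply: lime_le; first by apply: is_cvg_nneseries => k _ _; apply: integral_ge0 => x _; rewrite lee_fin Cnorm_ge0.
  by apply: nearW => N; under eq_bigr do rewrite IE; rewrite sumEFin lee_fin WB.
have iG : m.-integrable setT G.
  apply/integrableP; split => //.
  under eq_integral do rewrite gee0_abs//.
  by apply: le_lt_trans GB _; rewrite ltry.
have [ig eg] := fine_ae_integrable iG.
pose A := [set x | G x < +oo]%E.
have mA : measurable A by rewrite -[A]setTI; exact: emeasurable_fun_infty_o.
(* On the null set where G is infinite the terms are set to zero, so that the series converges at
   every point and its sum is measurable; no integral changes. *)
pose W' k x : R[i] := (\1_A x)%:C * W k x.
have mW' k : Cmeasurable (W' k).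
  apply: CmeasurableM; last exact: integrableC_measurable (iW k).
  by apply: Cmeasurable_real; exact: measurable_indic.
have aeW' : {ae m, forall x, A x}.
  apply: filterS (integrable_ae measurableT iG) => x /(_ I).
  by rewrite ge0_fin_numE.
have W'E x k : A x -> W' k x = W k x.
  by move=> Ax; rewrite /W' indicE mem_set// mul1r.
have W'0 x k : ~ A x -> W' k x = 0.
  by move=> Ax; rewrite /W' indicE memNset// mul0r.
have W'G N x : \sum_(0 <= k < N) Cnorm (W' k x) <= fine (G x).
  have [Ax|Ax] := pselect (A x); last first.
    by rewrite big1 ?fine_ge0// => k _; rewrite W'0// Cnorm0.
  under eq_bigr do rewrite W'E//.
  rewrite -lee_fin fineK; last by rewrite ge0_fin_numE.
  rewrite -sumEFin; apply: nneseries_lim_ge => k _ _.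
  by rewrite lee_fin Cnorm_ge0.
have sW' x : exists a, cvgC (fun N => \sum_(0 <= k < N) W' k x) a.
  apply: summable_cvgC; apply: (@le_lt_trans _ _ (fine (G x))%:E); last exact: ltry.
  apply: lime_le; first by apply: is_cvg_nneseries => k _ _; rewrite lee_fin Cnorm_ge0.
  by apply: nearW => N; rewrite sumEFin lee_fin W'G.
have [S hS] := choice sW'.
have normsum N x : Cnorm (\sum_(0 <= k < N) W' k x) <= fine (G x).
  apply: le_trans (W'G N x).
  elim: N => [|N IHN]; first by rewrite !big_geq// Cnorm0.
  by rewrite !big_nat_recr//= (le_trans (CnormD _ _))// lerD2r.
have mS : Cmeasurable S.
  apply: (Cmeasurable_lim (u := fun N x => \sum_(0 <= k < N) W' k x)) => // N.
  elim: N => [|N IHN].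
    rewrite (_ : (fun _ => _) = cst 0); first exact: Cmeasurable_cst.
    by apply/funext => x; rewrite big_geq.
  by under eq_fun do rewrite big_nat_recr//=; exact: CmeasurableD.
have SG x : Cnorm (S x) <= fine (G x).
  by apply: (cvgr_to_le (cvgC_Cnorm (hS x))); apply: nearW => N.
have iS := le_integrableC mS ig SG.
exists S; split=> //.
  apply: (@le_trans _ _ (\int[m]_x fine (G x))).
    by apply: le_Rintegral => //; exact: integrable_Cnorm.
  by rewrite eg -lee_fin fineK//; exact: integrable_fin_num.
move=> g mg g1.
have igW k : integrableC m (fun x => g x * W k x).
  apply: (le_integrableC (h := fun x => Cnorm (W k x))).
  - by apply: CmeasurableM => //; exact: integrableC_measurable (iW k).
  - exact: integrable_Cnorm.
  - by move=> x; rewrite CnormM ler_piMl ?Cnorm_ge0.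
have igW' k : integrableC m (fun x => g x * W' k x).
  apply: (le_integrableC (h := fun x => Cnorm (W k x))).
  - exact: CmeasurableM.
  - exact: integrable_Cnorm.
  - move=> x; rewrite CnormM; have [Ax|Ax] := pselect (A x).
      by rewrite W'E// ler_piMl ?Cnorm_ge0.
    by rewrite W'0// Cnorm0 mulr0 Cnorm_ge0.
have -> : (fun N => \sum_(0 <= k < N) integralC m (fun x => g x * W k x)) =
    (fun N => integralC m (fun x => g x * \sum_(0 <= k < N) W' k x)).
  apply/funext => N.
  transitivity (\sum_(0 <= k < N) integralC m (fun x => g x * W' k x)).
    apply: eq_bigr => k _; apply: ae_eq_integralC.
    - exact: integrableC_measurable.
    - exact: integrableC_measurable.
    - by apply: filterS aeW' => x Ax; rewrite W'E.
  rewrite -(integralC_sum _ (u := fun k x => g x * W' k x))//.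
  by congr integralC; apply/funext => x; rewrite mulr_sumr.
apply: (dominated_convergenceC (h := fun x => fine (G x)) _ _ _ _).2 => //.
- move=> N; apply: CmeasurableM => //.
  elim: N => [|N IHN].
    rewrite (_ : (fun _ => _) = cst 0); first exact: Cmeasurable_cst.
    by apply/funext => x; rewrite big_geq.
  by under eq_fun do rewrite big_nat_recr//=; exact: CmeasurableD.
- by move=> x; apply: cvgCM; [exact: cvgC_cst|exact: hS].
- move=> N x; rewrite CnormM; apply: le_trans (normsum N x).
  by rewrite ler_piMl ?Cnorm_ge0.
Qed.

End L1_series.

(** * Weighted densities and the equation on the Fourier side *)

Section barron_functions.
Context {R : realType} {n : nat}.
Implicit Types (x xi : 'rV[R]_n) (f g h u v w V W : 'rV[R]_n -> R[i]).

Local Notation mu := (lebesgue_rV R n).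
Local Notation c := ((2 * pi) ^- n : R).

Lemma norm_factor_gt0 : 0 < c.
Proof. by rewrite invr_gt0 exprn_gt0// mulr_gt0// pi_gt0. Qed.

Lemma fourierP (s : R) f : barron s f -> has_fourier f (fourier f).
Proof. by move=> [_ [g [fg _]]]; apply: xgetPex; exists g. Qed.

Lemma has_fourierE f g x : Cb0 f -> has_fourier f g -> f x = c%:C * cofourier g x.
Proof.
move=> cf fg; rewrite -(fourier_inversion x cf fg) mulrA -rmorphM mulVf ?rmorph1 ?mul1r//.
by have := norm_factor_gt0; rewrite invr_gt0; exact: lt0r_neq0.
Qed.

Lemma cofourier_inj g1 g2 : integrableC mu g1 -> integrableC mu g2 ->
  (forall x, cofourier g1 x = cofourier g2 x) -> {ae mu, forall xi, g1 xi = g2 xi}.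
Proof.
move=> i1 i2 e12.
have : {ae mu, forall xi, g1 xi - g2 xi = 0}.
  apply: cofourier_eq0; first exact: integrableCB.
  by move=> x; rewrite cofourierB// e12 subrr.
by apply: filterS => xi /subr0_eq.
Qed.

Lemma has_fourier_unique f g1 g2 : Cb0 f -> has_fourier f g1 -> has_fourier f g2 ->
  {ae mu, forall xi, g1 xi = g2 xi}.
Proof.
move=> cf h1 h2; apply: cofourier_inj; [exact: h1.1|exact: h2.1|move=> x].
by rewrite -(fourier_inversion x cf h1) -(fourier_inversion x cf h2).
Qed.

Lemma weighted0 g : weighted 0 g = g.
Proof. by apply/funext => xi; rewrite /weighted powRr0 mul1r. Qed.

Lemma weighted2 g : weighted 2 g = (fun xi => (1 + dotp xi xi)%:C * g xi).
Proof.
apply/funext => xi; rewrite /weighted powR_mulrn ?sqr_japanese//.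
by rewrite ltW// japanese_gt0.
Qed.

Lemma weight2_ge1 xi : 1 <= 1 + dotp xi xi.
Proof. by rewrite lerDl dotp_ge0. Qed.

Lemma weight2_gt0 xi : 0 < 1 + dotp xi xi.
Proof. exact: lt_le_trans (weight2_ge1 xi). Qed.

Lemma measurable_weight2 : measurable_fun setT (fun xi : 'rV[R]_n => 1 + dotp xi xi).
Proof.
under eq_fun do rewrite -sqr_japanese.
by apply: measurable_funX; exact: measurable_japanese.
Qed.

Lemma integrable_of_weighted2 (k : 'rV[R]_n -> R[i]) g : Cmeasurable k ->
  (forall xi, Cnorm (k xi) <= 1 + dotp xi xi) -> Cmeasurable g ->
  integrableC mu (weighted 2 g) -> integrableC mu (fun xi => k xi * g xi).
Proof.
move=> mk k1 mg; rewrite weighted2 => gi.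
apply: (le_integrableC _ (integrable_Cnorm gi)); first exact: CmeasurableM.
move=> xi; rewrite !CnormM Cnorm_real ger0_norm ?(ltW (weight2_gt0 _))//.
by rewrite ler_wpM2r ?Cnorm_ge0.
Qed.

Lemma integrable_weighted2 w : Cmeasurable w -> integrableC mu (weighted 2 w) -> integrableC mu w.
Proof.
move=> mw iw2.
have k1 xi : Cnorm (1 : R[i]) <= 1 + dotp xi xi.
  by rewrite [Cnorm _]ComplexField.Normc.normc1 weight2_ge1.
rewrite (_ : w = fun xi => 1 * w xi); last by apply/funext => xi; rewrite mul1r.
exact: (integrable_of_weighted2 (Cmeasurable_cst _ 1) k1 mw iw2).
Qed.

Lemma coor_le_weight2 i xi : `|xi ord0 i| <= 1 + dotp xi xi.
Proof.
have := coor_sqr_le_dotp i xi; have := sqr_ge0 (`|xi ord0 i| - 1).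
by rewrite -[xi ord0 i ^+ 2]real_normK ?num_real//; nra.
Qed.

(** Each derivative brings down a factor i xi_j. Such factors and their squares are bounded by
    <xi>^2, so two differentiations under the integral are legitimate, and summing the squares shows
    that 1 - Delta acts on densities as multiplication by <xi>^2. *)
Lemma cofourier_regular w : Cmeasurable w -> integrableC mu (weighted 2 w) ->
  [/\ forall i, partially_derivable i (cofourier w),
      forall i, partially_derivable i (partial i (cofourier w)) &
      forall x, cofourier w x - laplacian (cofourier w) x = cofourier (weighted 2 w) x].
Proof.
move=> mw iw2.
have iw := integrable_weighted2 mw iw2.
have mi (i : 'I_n) : Cmeasurable (fun xi : 'rV[R]_n => (0 +i* xi ord0 i : R[i])).
  by split => /=; [exact: measurable_cst|exact: measurable_coor].
have Ei (i : 'I_n) : (fun xi : 'rV[R]_n => (0 +i* dotp (unit_vec R i) xi : R[i])) =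
    (fun xi => 0 +i* xi ord0 i).
  by apply/funext => xi; rewrite dotp_unit.
have i1 (i : 'I_n) : integrableC mu (fun xi => (0 +i* dotp (unit_vec R i) xi) * w xi).
  under eq_fun do rewrite dotp_unit; apply: integrable_of_weighted2 => // xi.
  by rewrite Cnorm_imag coor_le_weight2.
have i2 (i : 'I_n) : integrableC mu (fun xi => (0 +i* dotp (unit_vec R i) xi) *
    ((0 +i* dotp (unit_vec R i) xi) * w xi)).
  under eq_fun do rewrite dotp_unit mulrA.
  apply: integrable_of_weighted2 => //; first exact: CmeasurableM.
  move=> xi; rewrite CnormM Cnorm_imag -expr2 real_normK ?num_real//.
  by rewrite (le_trans (coor_sqr_le_dotp i xi))// lerDr.
have p1 (i : 'I_n) : partial i (cofourier w) =
    cofourier (fun xi => (0 +i* dotp (unit_vec R i) xi) * w xi).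
  apply/funext => x; have [dr di] := is_derive_cofourier x iw (i1 i).
  apply: complex_ext => /=.
    exact: (@derive_val _ _ _ _ _ _ _ dr).
  exact: (@derive_val _ _ _ _ _ _ _ di).
have p2 (i : 'I_n) : partial i (partial i (cofourier w)) =
    cofourier (fun xi => (0 +i* dotp (unit_vec R i) xi) *
      ((0 +i* dotp (unit_vec R i) xi) * w xi)).
  rewrite p1; apply/funext => x; have [dr di] := is_derive_cofourier x (i1 i) (i2 i).
  apply: complex_ext => /=.
    exact: (@derive_val _ _ _ _ _ _ _ dr).
  exact: (@derive_val _ _ _ _ _ _ _ di).
split.
- move=> i x; have [dr di] := is_derive_cofourier x iw (i1 i).
  by split; [exact: (@ex_derive _ _ _ _ _ _ _ dr)|exact: (@ex_derive _ _ _ _ _ _ _ di)].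
- move=> i x; rewrite p1; have [dr di] := is_derive_cofourier x (i1 i) (i2 i).
  by split; [exact: (@ex_derive _ _ _ _ _ _ _ dr)|exact: (@ex_derive _ _ _ _ _ _ _ di)].
- move=> x; rewrite /laplacian; under eq_bigr do rewrite p2.
  rewrite -cofourier_sum// -cofourierB//; last exact: integrableC_sum.
  rewrite weighted2; congr cofourier; apply/funext => xi.
  have -> : (1 + dotp xi xi)%:C * w xi = w xi + (dotp xi xi)%:C * w xi.
    by rewrite rmorphD rmorph1 mulrDl mul1r.
  congr (_ + _); rewrite [dotp xi xi]/dotp (big_morph (fun t : R => t%:C) (id1 := 0) (op1 := +%R))//; last first.
    by move=> s t; rewrite rmorphD.
  rewrite mulr_suml -sumrN; apply: eq_bigr => i _.
  rewrite /= ?dotp_unit mulrA -mulNr; congr (_ * _).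
  by apply: complex_ext; rewrite !ReImE /=; ring.
Qed.

Lemma L1norm_ge0 g : 0 <= L1norm g.
Proof. by apply: Rintegral_ge0 => xi _; exact: Cnorm_ge0. Qed.

Lemma L1normZ (z : R[i]) g : integrableC mu g -> L1norm (fun xi => z * g xi) = Cnorm z * L1norm g.
Proof.
move=> gi; rewrite /L1norm -RintegralZl//; last exact: integrable_Cnorm.
by apply: eq_Rintegral => xi _; rewrite CnormM.
Qed.

Lemma le_L1norm f g : integrableC mu f -> integrableC mu g ->
  (forall xi, Cnorm (f xi) <= Cnorm (g xi)) -> L1norm f <= L1norm g.
Proof. by move=> fi gi fg; apply: le_Rintegral => //; exact: integrable_Cnorm. Qed.

Lemma ae_eq_L1norm f g : Cmeasurable f -> Cmeasurable g ->
  {ae mu, forall xi, f xi = g xi} -> L1norm f = L1norm g.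
Proof.
move=> mf mg fg; rewrite /L1norm /Rintegral; congr fine.
apply: ae_eq_integral => //; [exact: measurable_ECnorm|exact: measurable_ECnorm|].
by apply: filterS fg => xi /= ->.
Qed.

(** The Fourier multiplier of (1 - Delta)^-1, of modulus at most one. *)
Definition unweight g xi : R[i] := (1 + dotp xi xi)^-1%:C * g xi.

Lemma weighted_unweight g : weighted 2 (unweight g) = g.
Proof.
rewrite weighted2; apply/funext => xi.
by rewrite /unweight mulrA -rmorphM mulfV ?rmorph1 ?mul1r// gt_eqF// weight2_gt0.
Qed.

Lemma measurable_inv_weight2 :
  Cmeasurable (fun xi : 'rV[R]_n => ((1 + dotp xi xi)^-1)%:C : R[i]).
Proof.
apply: Cmeasurable_real.
have mp : measurable_fun setT (fun xi : 'rV[R]_n => (1 + dotp xi xi) `^ (-1)).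
  have mr : measurable_fun setT (fun s : R => s `^ (-1)) by exact: measurable_powR.
  exact: (measurableT_comp mr measurable_weight2).
by under eq_fun do rewrite -powR_inv1 ?(ltW (weight2_gt0 _))//.
Qed.

Lemma inv_weight2_le1 xi : Cnorm ((1 + dotp xi xi)^-1%:C : R[i]) <= 1.
Proof.
rewrite Cnorm_real ger0_norm ?invr_ge0 ?(ltW (weight2_gt0 _))//.
by rewrite invf_le1 ?weight2_ge1 ?weight2_gt0.
Qed.

Lemma integrable_unweight g : integrableC mu g -> integrableC mu (unweight g).
Proof.
move=> gi; apply: (le_integrableC _ (integrable_Cnorm gi)).
  by apply: CmeasurableM; [exact: measurable_inv_weight2|exact: integrableC_measurable gi].
by move=> xi; rewrite CnormM ler_piMl ?Cnorm_ge0// inv_weight2_le1.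
Qed.

Lemma L1norm_unweight g : integrableC mu g -> L1norm (unweight g) <= L1norm g.
Proof.
move=> gi; apply: le_L1norm => //; first exact: integrable_unweight.
by move=> xi; rewrite CnormM ler_piMl ?Cnorm_ge0// inv_weight2_le1.
Qed.

(* Terms of the Neumann series for [S + c gV * (S / <xi>^2) = gf], where [S]
   stands for [<xi>^2 u^]. *)
Fixpoint neumann gV gf (k : nat) : 'rV[R]_n -> R[i] :=
  if k is k'.+1 then fun xi => (- c)%:C * convolution gV (unweight (neumann gV gf k')) xi
  else gf.

Lemma integrable_neumann gV gf k : integrableC mu gV -> integrableC mu gf ->
  integrableC mu (neumann gV gf k).
Proof.
move=> iV iF; elim: k => [|k IHk] //=.
apply: integrableCZ; apply: integrableC_convolution => //.
exact: integrable_unweight.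
Qed.

Lemma L1norm_neumann gV gf k : integrableC mu gV -> integrableC mu gf ->
  L1norm (neumann gV gf k) <= (c * L1norm gV) ^+ k * L1norm gf.
Proof.
move=> iV iF; elim: k => [|k IHk] /=; first by rewrite expr0 mul1r.
have iN := integrable_neumann k iV iF; have iU := integrable_unweight iN.
rewrite L1normZ; last exact: integrableC_convolution.
rewrite Cnorm_real normrN gtr0_norm ?norm_factor_gt0// exprS -!mulrA.
rewrite ler_wpM2l ?(ltW norm_factor_gt0)//.
apply: le_trans (L1norm_convolution iV iU) _; rewrite ler_wpM2l ?L1norm_ge0//.
exact: le_trans (L1norm_unweight iN) IHk.
Qed.

Lemma cofourier_neumannS gV gf k x : integrableC mu gV -> integrableC mu gf ->
  cofourier (neumann gV gf k.+1) x =
  - (c%:C * cofourier gV x) * cofourier (unweight (neumann gV gf k)) x.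
Proof.
move=> iV iF; have iU := integrable_unweight (integrable_neumann k iV iF).
rewrite /= cofourierZ; last exact: integrableC_convolution.
by rewrite cofourier_convolution// rmorphN mulrA mulNr.
Qed.

Lemma geometric_sum_le (q : R) N : 0 <= q -> q < 1 -> \sum_(0 <= k < N) q ^+ k <= (1 - q)^-1.
Proof.
move=> q0 q1; rewrite big_mkord -[leRHS]mul1r ler_pdivlMr ?subr_gt0// mulrC.
by rewrite -opprB mulNr -subrX1 opprB lerBlDr lerDl exprn_ge0.
Qed.

(** The convolution equation is recorded after [cofourier], where it is scalar at each [x]; this
    suffices for the differential equation and avoids convergence of convolutions in L^1. *)
Lemma fourier_side_solution gV gf : integrableC mu gV -> integrableC mu gf ->
  c * L1norm gV < 1 ->
  exists S, [/\ integrableC mu S,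
    L1norm S <= (1 - c * L1norm gV)^-1 * L1norm gf &
    forall x, cofourier S x + c%:C * cofourier gV x * cofourier (unweight S) x = cofourier gf x].
Proof.
move=> iV iF q1; set q := c * L1norm gV.
have q0 : 0 <= q by rewrite mulr_ge0 ?L1norm_ge0// ltW// norm_factor_gt0.
have iN k := integrable_neumann k iV iF.
have NB N : \sum_(0 <= k < N) L1norm (neumann gV gf k) <= (1 - q)^-1 * L1norm gf.
  apply: (@le_trans _ _ (\sum_(0 <= k < N) q ^+ k * L1norm gf)).
    by apply: ler_sum => k _; exact: L1norm_neumann.
  by rewrite -mulr_suml ler_wpM2r ?L1norm_ge0// geometric_sum_le.
have [S [iS SB HS]] := L1_series_cvg iN NB.
exists S; split=> // x.
have me : Cmeasurable (fun xi => expi (dotp x xi)) by apply: Cmeasurable_expi; exact: measurable_dotp.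
have e1 xi : Cnorm (expi (dotp x xi)) <= 1 by rewrite Cnorm_expi.
have c1 : cvgC (fun N => \sum_(0 <= k < N) cofourier (neumann gV gf k) x) (cofourier S x).
  exact: HS me e1.
(* The same L^1 series, now tested with exp(i x . xi) / <xi>^2, still of modulus at most one. *)
have c2 : cvgC (fun N => \sum_(0 <= k < N) cofourier (unweight (neumann gV gf k)) x)
    (cofourier (unweight S) x).
  have := HS (fun xi => expi (dotp x xi) * ((1 + dotp xi xi)^-1)%:C).
  have E w : integralC mu (fun xi => expi (dotp x xi) * ((1 + dotp xi xi)^-1)%:C * w xi) =
      cofourier (unweight w) x.
    by congr integralC; apply/funext => xi; rewrite mulrA.
  rewrite E (_ : (fun N => _) =
    (fun N => \sum_(0 <= k < N) cofourier (unweight (neumann gV gf k)) x)); last first.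
    by apply/funext => N; apply: eq_bigr => k _; rewrite E.
  apply; first by apply: CmeasurableM => //; exact: measurable_inv_weight2.
  by move=> xi; rewrite CnormM Cnorm_expi mul1r inv_weight2_le1.
(* By the Neumann recursion, [N.+1] terms of the first series equal the transform of [gf] minus c
   times that of [gV] times [N] terms of the second; the shift by one leaves the limit unchanged. *)
have := cvgCD (cvgC_cst (cofourier gf x)) (cvgCM (cvgC_cst (- (c%:C * cofourier gV x))) c2).
rewrite (_ : (fun N => _) = (fun N => \sum_(0 <= k < N.+1) cofourier (neumann gV gf k) x)).
  move=> /(cvgC_unique (cvgC_shift c1)) ->.
  by rewrite mulNr subrK.
apply/funext => N; rewrite big_nat_recl// mulr_sumr; congr (_ + _).
by apply: eq_bigr => k _; rewrite cofourier_neumannS.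
Qed.

End barron_functions.

(** * The Schrödinger equation as an identity between transforms *)

Section schrodinger_equation.
Context {R : realType} {n : nat}.
Implicit Types (x xi : 'rV[R]_n) (f g h u v w V : 'rV[R]_n -> R[i]).

Local Notation mu := (lebesgue_rV R n).
Local Notation c := ((2 * pi) ^- n : R).

(** The solution and [f] each carry one factor c, while the product with [V] carries two; cancelling
    a common c leaves one in front of [gV]. The equivalence yields existence in one direction and
    uniqueness in the other. *)
Lemma schrodinger_solutionE V f gV gf w :
  (forall x, V x = c%:C * cofourier gV x) -> (forall x, f x = c%:C * cofourier gf x) ->
  Cmeasurable w -> integrableC mu (weighted 2 w) ->
  schrodinger_solution V f (fun x => c%:C * cofourier w x) <->
  forall x, cofourier (weighted 2 w) x + c%:C * cofourier gV x * cofourier w x = cofourier gf x.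
Proof.
move=> VE fE mw iw2; have iw := integrable_weighted2 mw iw2.
have c0 : c%:C != 0 :> R[i] by rewrite fmorph_eq0 gt_eqF// norm_factor_gt0.
pose w' xi := c%:C * w xi.
have wE : (fun x => c%:C * cofourier w x) = cofourier w'.
  by apply/funext => x; rewrite cofourierZ.
have W2E : weighted 2 w' = (fun xi => c%:C * weighted 2 w xi).
  by rewrite !weighted2; apply/funext => xi; rewrite mulrCA.
have mw' : Cmeasurable w' by apply: CmeasurableM => //; exact: Cmeasurable_cst.
have iw2' : integrableC mu (weighted 2 w') by rewrite W2E; exact: integrableCZ.
have [d1 d2 lap] := cofourier_regular mw' iw2'.
have E x : cofourier w' x - laplacian (cofourier w') x + V x * cofourier w' x =
    c%:C * (cofourier (weighted 2 w) x + c%:C * cofourier gV x * cofourier w x).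
  by rewrite lap W2E /w' !cofourierZ// VE; ring.
rewrite wE; split=> [[_ [_ eqn]] x|eqn].
  by apply: (mulfI c0); rewrite -E -fE eqn.
by split=> //; split=> // x; rewrite E eqn fE.
Qed.

Lemma Cmeasurable_weighted2 w : Cmeasurable w -> Cmeasurable (weighted 2 w).
Proof.
move=> mw; rewrite weighted2; apply: CmeasurableM => //; apply: Cmeasurable_real.
exact: measurable_weight2.
Qed.

End schrodinger_equation.

Theorem theorem3p1 (R : realType) (n : nat) (hn : (0 < n)%N)
    (V f : 'rV[R]_n -> R[i]) (kappa : R) :
  barron 0 V ->
  kappa = (2 * pi) ^- n * barron_norm 0 V ->
  kappa < 1 ->
  barron 0 f ->
  exists u : 'rV[R]_n -> R[i],
    [/\ barron 2 u,
        schrodinger_solution V f u,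
        forall v, barron 2 v -> schrodinger_solution V f v -> v = u &
        barron_norm 2 u <= (1 - kappa)^-1 * barron_norm 0 f].
Proof.
move=> bV -> k1 bf.
have hV := fourierP bV; have hf := fourierP bf.
rewrite /barron_norm !weighted0 in k1 *.
set gV := fourier V in hV k1 *; set gf := fourier f in hf *.
have iV : integrableC (lebesgue_rV R n) gV := hV.1.
have iF : integrableC (lebesgue_rV R n) gf := hf.1.
have VE x := has_fourierE x bV.1 hV.
have fE x := has_fourierE x bf.1 hf.
have [S [iS SB ES]] := fourier_side_solution iV iF k1.
pose w := unweight S.
have iw : integrableC (lebesgue_rV R n) w := integrable_unweight iS.
have mw := integrableC_measurable iw.
have w2 : weighted 2 w = S by exact: weighted_unweight.
have iw2 : integrableC (lebesgue_rV R n) (weighted 2 w) by rewrite w2.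
pose u x := ((2 * pi) ^- n)%:C * cofourier w x.
have hu : has_fourier u w by exact: has_fourier_cofourier.
have cu : Cb0 u.
  have -> : u = cofourier (fun xi => ((2 * pi) ^- n)%:C * w xi).
    by apply/funext => x; rewrite cofourierZ.
  by apply: Cb0_cofourier; exact: integrableCZ.
have bu : barron 2 u by split=> //; exists w.
exists u; split=> //.
- by apply/(schrodinger_solutionE VE fE mw iw2) => x; rewrite w2.
- move=> v [cv [h [hv ih2]]] sv.
  have ih : integrableC (lebesgue_rV R n) h := hv.1.
  (* Inversion holds at every point, so a competitor [v] is determined everywhere by any of its
     densities. *)
  have vE : v = (fun x => ((2 * pi) ^- n)%:C * cofourier h x).
    by apply/funext => x; exact: has_fourierE.
  rewrite vE in sv; have mh := integrableC_measurable ih.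
  have Eh := (schrodinger_solutionE VE fE mh ih2).1 sv.
  pose d xi := w xi - h xi.
  have id : integrableC (lebesgue_rV R n) d by exact: integrableCB.
  have d2 : weighted 2 d = (fun xi => S xi - weighted 2 h xi).
    by rewrite -w2 !weighted2; apply/funext => xi; rewrite mulrBr.
  have id2 : integrableC (lebesgue_rV R n) (weighted 2 d).
    by rewrite d2; exact: integrableCB.
  have iC := integrableC_convolution iV id.
  (* Subtracting the two equations removes the right-hand side; what remains says that <xi>^2 d and
     - c (gV * d) have the same transform, hence agree almost everywhere. *)
  have Ed x : cofourier (weighted 2 d) x =
      cofourier (fun xi => (- ((2 * pi) ^- n))%:C * convolution gV d xi) x.
    rewrite d2 cofourierB// cofourierZ// cofourier_convolution// cofourierB//.
    have := ES x; have := Eh x; rewrite -/w rmorphN mulrA mulNr.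
    move: (_%:C * cofourier gV x) (cofourier h x) (cofourier w x) => a b e.
    move: (cofourier (weighted 2 h) x) (cofourier S x) => A B <- /eqP.
    by rewrite -subr_eq => /eqP <-; ring.
  have aed := cofourier_inj id2 (integrableCZ _ iC) Ed.
  have dle : L1norm d <= L1norm (weighted 2 d).
    apply: le_L1norm => // xi; rewrite weighted2 CnormM Cnorm_real.
    rewrite ler_peMl ?Cnorm_ge0// (le_trans (weight2_ge1 xi))// ler_norm//.
  have d2le : L1norm (weighted 2 d) <= ((2 * pi) ^- n * L1norm gV) * L1norm d.
    rewrite (ae_eq_L1norm _ _ aed); last 2 first.
    + exact: integrableC_measurable id2.
    + exact: (integrableC_measurable (integrableCZ _ iC)).
    rewrite L1normZ// Cnorm_real normrN gtr0_norm ?norm_factor_gt0// -mulrA.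
    by rewrite ler_wpM2l ?(ltW norm_factor_gt0)// L1norm_convolution.
  have d0 : L1norm d = 0.
    (* A positive norm would satisfy |d|_1 <= |<xi>^2 d|_1 <= kappa |d|_1 with kappa < 1. *)
    apply/eqP; rewrite eq_le L1norm_ge0 andbT leNgt; apply/negP => dp.
    have := le_trans dle d2le; rewrite -[leLHS]mul1r ler_pM2r// leNgt.
    by rewrite k1.
  (* The bound |cofourier d| <= |d|_1 = 0 gives equality at every point, as functions and not merely
     almost everywhere. *)
  rewrite vE; apply/funext => x; congr (_ * _); apply/esym/eqP.
  rewrite -subr_eq0 -cofourierB//; apply/eqP/Cnorm_eq0/eqP.
  by rewrite eq_le Cnorm_ge0 andbT -d0 Cnorm_cofourier.
(* [barron_norm] measures the density selected by [fourier], which is known to coincide with [w]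
   only up to a null set. *)
- have aeu := has_fourier_unique cu (fourierP bu) hu.
  have mu2 : {ae lebesgue_rV R n, forall xi, weighted 2 (fourier u) xi = weighted 2 w xi}.
    by apply: filterS aeu => xi; rewrite /weighted => ->.
  rewrite (ae_eq_L1norm _ _ mu2) ?w2//.
    apply: Cmeasurable_weighted2; exact: integrableC_measurable (fourierP bu).1.
  exact: (integrableC_measurable iS).
Qed.
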